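(* Let $n,p,J\ge 2$ be integers, let $\mathbf{x}_1,\dots,\mathbf{x}_n\in\mathbb{R}^p$ with labels $y_1,\dots,y_n\in\{1,\dots,J\}$, let $X=[\mathbf{x}_1,\dots,\mathbf{x}_n]\in\mathbb{R}^{p\times n}$, and let $c_{ij}=1$ if $y_i\neq j$ and $c_{ij}=0$ otherwise. Let $\lambda_1,\lambda_2\ge 0$ and $\lambda_3>0$. Let $\mathcal{D}=\{(W,\mathbf{b})\in\mathbb{R}^{p\times J}\times\mathbb{R}^J:\ W\mathbf{e}=\mathbf{0},\ \mathbf{e}^\top\mathbf{b}=0\}$. Problem (P1): minimize over $W,U\in\mathbb{R}^{p\times J}$, $\mathbf{b}\in\mathbb{R}^J$, $A\in\mathbb{R}^{n\times J}$ the function $$F_1(W,\mathbf{b},A,U)=\tfrac1n\sum_{i,j}c_{ij}[a_{ij}]_++\lambda_1\|U\|_1+\tfrac{\lambda_2}{2}\|W\|_F^2+\tfrac{\lambda_3}{2}\|\mathbf{b}\|_2^2$$ subject to $A=X^\top W+\mathbf{e}\mathbf{b}^\top+E$, $U=W$, $(W,\mathbf{b})\in\mathcal{D}$. Its augmented Lagrangian, for penalty parameters $\alpha,\mu>0$, is $$\mathcal{L}_1=F_1(W,\mathbf{b},A,U)+\langle \Lambda,W-U\rangle+\tfrac{\mu}{2}\|W-U\|_F^2+\langle\Pi,X^\top W+\mathbf{e}\mathbf{b}^\top-A+E\rangle+\tfrac{\alpha}{2}\|X^\top W+\mathbf{e}\mathbf{b}^\top-A+E\|_F^2 .$$ Starting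 from any initial point, the ADMM sequence $\mathbf{z}_1^{(k)}=(W^{(k)},\mathbf{b}^{(k)},A^{(k)},U^{(k)},\Pi^{(k)},\Lambda^{(k)})$ is defined by: $(W^{(k+1)},\mathbf{b}^{(k+1)})=\arg\min_{(W,\mathbf{b})\in\mathcal{D}}\mathcal{L}_1(W,\mathbf{b},A^{(k)},U^{(k)},\Pi^{(k)},\Lambda^{(k)})$; $(A^{(k+1)},U^{(k+1)})=\arg\min_{A,U}\mathcal{L}_1(W^{(k+1)},\mathbf{b}^{(k+1)},A,U,\Pi^{(k)},\Lambda^{(k)})$; $\Pi^{(k+1)}=\Pi^{(k)}+\alpha(X^\top W^{(k+1)}+\mathbf{e}(\mathbf{b}^{(k+1)})^\top-A^{(k+1)}+E)$; $\Lambda^{(k+1)}=\Lambda^{(k)}+\mu(W^{(k+1)}-U^{(k+1)})$. Problem (P2), for fixed $q\in\{2,\infty\}$: minimize over $W,U,V\in\mathbb{R}^{p\times J}$, $\mathbf{b}\in\mathbb{R}^J$, $A\in\mathbb{R}^{n\times J}$ the function $$F_2(W,\mathbf{b},A,U,V)=\tfrac1n\sum_{i,j}c_{ij}[a_{ij}]_++\lambda_1\|U\|_1+\lambda_2\sum_{j=1}^p\|\mathbf{v}^j\|_q+\tfrac{\lambda_3}{2}\|\mathbf{b}\|_2^2$$ subject to $A=X^\top W+\mathbf{e}\mathbf{b}^\top+E$, $U=W$, $V=W$, $(W,\mathbf{b})\in\mathcal{D}$. Its augmented Lagrangian, for $\alpha,\mu,\nu>0$, is $$\mathcal{L}_2=F_2+\langle\Pi,X^\top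 W+\mathbf{e}\mathbf{b}^\top-A+E\rangle+\tfrac{\alpha}{2}\|X^\top W+\mathbf{e}\mathbf{b}^\top-A+E\|_F^2+\langle\Lambda,W-U\rangle+\tfrac{\mu}{2}\|W-U\|_F^2+\langle\Gamma,W-V\rangle+\tfrac{\nu}{2}\|W-V\|_F^2 .$$ Starting from any initial point, the ADMM sequence $\mathbf{z}_2^{(k)}=(W^{(k)},\mathbf{b}^{(k)},A^{(k)},U^{(k)},V^{(k)},\Pi^{(k)},\Lambda^{(k)},\Gamma^{(k)})$ is defined by: $(W^{(k+1)},\mathbf{b}^{(k+1)})=\arg\min_{(W,\mathbf{b})\in\mathcal{D}}\mathcal{L}_2(W,\mathbf{b},A^{(k)},U^{(k)},V^{(k)},\Pi^{(k)},\Lambda^{(k)},\Gamma^{(k)})$; $(A^{(k+1)},U^{(k+1)},V^{(k+1)})=\arg\min_{A,U,V}\mathcal{L}_2(W^{(k+1)},\mathbf{b}^{(k+1)},A,U,V,\Pi^{(k)},\Lambda^{(k)},\Gamma^{(k)})$; $\Pi^{(k+1)}=\Pi^{(k)}+\alpha(X^\top W^{(k+1)}+\mathbf{e}(\mathbf{b}^{(k+1)})^\top-A^{(k+1)}+E)$; $\Lambda^{(k+1)}=\Lambda^{(k)}+\mu(W^{(k+1)}-U^{(k+1)})$; $\Gamma^{(k+1)}=\Gamma^{(k)}+\nu(W^{(k+1)}-V^{(k+1)})$. Let $F_1^{(k)}=F_1(W^{(k)},\mathbf{b}^{(k)},A^{(k)},U^{(k)})$ along $\{\mathbf{z}_1^{(k)}\}$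 and $F_2^{(k)}=F_2(W^{(k)},\mathbf{b}^{(k)},A^{(k)},U^{(k)},V^{(k)})$ along $\{\mathbf{z}_2^{(k)}\}$, and let $F_1^*,F_2^*$ be the optimal values of (P1), (P2). Then $F_1^{(k)}\to F_1^*$ and $F_2^{(k)}\to F_2^*$; along each sequence $\|X^\top W^{(k)}+\mathbf{e}(\mathbf{b}^{(k)})^\top+E-A^{(k)}\|_F\to0$ and $\|W^{(k)}-U^{(k)}\|_F\to0$; and along $\{\mathbf{z}_2^{(k)}\}$, $\|W^{(k)}-V^{(k)}\|_F\to 0$. In addition, if $\lambda_2>0$ and $\lambda_3>0$ in (P1), then $\{\mathbf{z}_1^{(k)}\}$ converges linearly.
   Context: $\mathbf{e}$ denotes an all-ones vector and $E$ an all-ones matrix of appropriate size. $[t]_+=\max(0,t)$. $\|U\|_1=\sum_{i,j}|u_{ij}|$; $\|\cdot\|_F$ is the Frobenius norm; $\langle P,Q\rangle=\operatorname{tr}(P^\top Q)$. $\mathbf{v}^j$ denotes the $j$-th row of $V$. Problems (P1) and (P2) are reformulations (via auxiliary variables $A,U,V$) of the regularized multiclass SVM $\min_{W,\mathbf{b}}\frac1n\sum_{i,j}c_{ij}[b_j+\mathbf{w}_j^\top\mathbf{x}_i+1]_++\lambda_1\|W\|_1+\lambda_2\phi(W)+\frac{\lambda_3}{2}\|\mathbf{b}\|_2^2$ s.t. $W\mathbf{e}=\mathbf{0}$, $\mathbf{e}^\top\mathbf{b}=0$, with $\phi(W)=\frac12\|W\|_F^2$ for (P1) and $\phi(W)=\sum_j\|\mathbf{w}^j\|_q$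 for (P2). *)

(* Defs.v *)
From HB Require Import structures.
From mathcomp Require Import all_boot all_order all_algebra.
From mathcomp Require Import all_classical all_reals all_analysis.
Set Implicit Arguments. Unset Strict Implicit. Unset Printing Implicit Defensive.
Import Order.TTheory GRing.Theory Num.Theory.
Import numFieldNormedType.Exports.
Local Open Scope ring_scope.
Local Open Scope classical_set_scope.

Section MSVM.
Variable R : realType.

Definition pospart (t : R) : R := Num.max t 0.

Definition l1norm m k (U : 'M[R]_(m, k)) : R := \sum_i \sum_j `|U i j|.

Definition frob2 m k (M : 'M[R]_(m, k)) : R := \sum_i \sum_j (M i j) ^+ 2.
Definition frob m k (M : 'M[R]_(m, k)) : R := Num.sqrt (frob2 M).

Definition inner m k (P Q : 'M[R]_(m, k)) : R := \tr (P^T *m Q).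

Inductive qexp := q_two | q_inf.

Definition rownorm (q : qexp) k (v : 'rV[R]_k) : R :=
  match q with
  | q_two => Num.sqrt (\sum_l (v 0 l) ^+ 2)
  | q_inf => \big[Num.max/0]_l `|v 0 l|
  end.

Definition groupnorm (q : qexp) m k (V : 'M[R]_(m, k)) : R :=
  \sum_j rownorm q (row j V).

Variables (n p J : nat).

Definition cost (y : 'I_n -> 'I_J) (i : 'I_n) (j : 'I_J) : R :=
  if y i != j then 1 else 0.

Definition hinge (y : 'I_n -> 'I_J) (A : 'M[R]_(n, J)) : R :=
  n%:R^-1 * \sum_i \sum_j cost y i j * pospart (A i j).

Definition inD (W : 'M[R]_(p, J)) (b : 'cV[R]_J) : Prop :=
  W *m (const_mx 1 : 'cV[R]_J) = 0 /\ (const_mx 1 : 'rV[R]_J) *m b = 0.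

Definition resid (X : 'M[R]_(p, n)) (W : 'M[R]_(p, J)) (b : 'cV[R]_J)
  (A : 'M[R]_(n, J)) : 'M[R]_(n, J) :=
  X^T *m W + (const_mx 1 : 'cV[R]_n) *m b^T - A + const_mx 1.

Definition F1 (y : 'I_n -> 'I_J) (lam1 lam2 lam3 : R)
  (W : 'M[R]_(p, J)) (b : 'cV[R]_J) (A : 'M[R]_(n, J)) (U : 'M[R]_(p, J)) : R :=
  hinge y A + lam1 * l1norm U + lam2 / 2 * frob2 W + lam3 / 2 * frob2 b.

Definition feas1 (X : 'M[R]_(p, n)) (W : 'M[R]_(p, J)) (b : 'cV[R]_J)
  (A : 'M[R]_(n, J)) (U : 'M[R]_(p, J)) : Prop :=
  [/\ A = X^T *m W + (const_mx 1 : 'cV[R]_n) *m b^T + const_mx 1, U = W & inD W b].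

Definition F1star (X : 'M[R]_(p, n)) (y : 'I_n -> 'I_J) (lam1 lam2 lam3 : R) : R :=
  inf [set v | exists W b A U, feas1 X W b A U /\ v = F1 y lam1 lam2 lam3 W b A U].

Definition L1 (X : 'M[R]_(p, n)) (y : 'I_n -> 'I_J) (lam1 lam2 lam3 alpha mu : R)
  (W : 'M[R]_(p, J)) (b : 'cV[R]_J) (A : 'M[R]_(n, J)) (U : 'M[R]_(p, J))
  (Pi : 'M[R]_(n, J)) (Lam : 'M[R]_(p, J)) : R :=
  F1 y lam1 lam2 lam3 W b A U + inner Lam (W - U) + mu / 2 * frob2 (W - U)
  + inner Pi (resid X W b A) + alpha / 2 * frob2 (resid X W b A).

Definition admm1 (X : 'M[R]_(p, n)) (y : 'I_n -> 'I_J) (lam1 lam2 lam3 alpha mu : R)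
  (Wk : nat -> 'M[R]_(p, J)) (bk : nat -> 'cV[R]_J) (Ak : nat -> 'M[R]_(n, J))
  (Uk : nat -> 'M[R]_(p, J)) (Pik : nat -> 'M[R]_(n, J)) (Lamk : nat -> 'M[R]_(p, J))
  : Prop :=
  let L := L1 X y lam1 lam2 lam3 alpha mu in
  forall k : nat,
  [/\ inD (Wk k.+1) (bk k.+1)
      /\ (forall W b, inD W b ->
           L (Wk k.+1) (bk k.+1) (Ak k) (Uk k) (Pik k) (Lamk k)
           <= L W b (Ak k) (Uk k) (Pik k) (Lamk k)),
      (forall A U,
           L (Wk k.+1) (bk k.+1) (Ak k.+1) (Uk k.+1) (Pik k) (Lamk k)
           <= L (Wk k.+1) (bk k.+1) A U (Pik k) (Lamk k)),
      Pik k.+1 = Pik k + alpha *: resid X (Wk k.+1) (bk k.+1) (Ak k.+1)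
    & Lamk k.+1 = Lamk k + mu *: (Wk k.+1 - Uk k.+1)].

(* linear (R-linear) convergence of {z1^(k)}:
   ||z^(k) - z*|| <= C r^k for some limit point z*, C, and 0 < r < 1 *)
Definition lin_conv1
  (Wk : nat -> 'M[R]_(p, J)) (bk : nat -> 'cV[R]_J) (Ak : nat -> 'M[R]_(n, J))
  (Uk : nat -> 'M[R]_(p, J)) (Pik : nat -> 'M[R]_(n, J)) (Lamk : nat -> 'M[R]_(p, J))
  : Prop :=
  exists (Ws : 'M[R]_(p, J)) (bs : 'cV[R]_J) (As : 'M[R]_(n, J))
         (Us : 'M[R]_(p, J)) (Pis : 'M[R]_(n, J)) (Lams : 'M[R]_(p, J))
         (C r : R),
    0 < r < 1 /\
    forall k : nat,
      frob (Wk k - Ws) + frob (bk k - bs) + frob (Ak k - As) + frob (Uk k - Us)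
      + frob (Pik k - Pis) + frob (Lamk k - Lams) <= C * r ^+ k.

Definition F2 (q : qexp) (y : 'I_n -> 'I_J) (lam1 lam2 lam3 : R)
  (W : 'M[R]_(p, J)) (b : 'cV[R]_J) (A : 'M[R]_(n, J)) (U V : 'M[R]_(p, J)) : R :=
  hinge y A + lam1 * l1norm U + lam2 * groupnorm q V + lam3 / 2 * frob2 b.

Definition feas2 (X : 'M[R]_(p, n)) (W : 'M[R]_(p, J)) (b : 'cV[R]_J)
  (A : 'M[R]_(n, J)) (U V : 'M[R]_(p, J)) : Prop :=
  [/\ A = X^T *m W + (const_mx 1 : 'cV[R]_n) *m b^T + const_mx 1, U = W, V = W
    & inD W b].

Definition F2star (q : qexp) (X : 'M[R]_(p, n)) (y : 'I_n -> 'I_J)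
  (lam1 lam2 lam3 : R) : R :=
  inf [set v | exists W b A U V, feas2 X W b A U V /\
                 v = F2 q y lam1 lam2 lam3 W b A U V].

Definition L2 (q : qexp) (X : 'M[R]_(p, n)) (y : 'I_n -> 'I_J)
  (lam1 lam2 lam3 alpha mu nu : R)
  (W : 'M[R]_(p, J)) (b : 'cV[R]_J) (A : 'M[R]_(n, J)) (U V : 'M[R]_(p, J))
  (Pi : 'M[R]_(n, J)) (Lam Gam : 'M[R]_(p, J)) : R :=
  F2 q y lam1 lam2 lam3 W b A U V
  + inner Pi (resid X W b A) + alpha / 2 * frob2 (resid X W b A)
  + inner Lam (W - U) + mu / 2 * frob2 (W - U)
  + inner Gam (W - V) + nu / 2 * frob2 (W - V).

Definition admm2 (q : qexp) (X : 'M[R]_(p, n)) (y : 'I_n -> 'I_J)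
  (lam1 lam2 lam3 alpha mu nu : R)
  (Wk : nat -> 'M[R]_(p, J)) (bk : nat -> 'cV[R]_J) (Ak : nat -> 'M[R]_(n, J))
  (Uk Vk : nat -> 'M[R]_(p, J)) (Pik : nat -> 'M[R]_(n, J))
  (Lamk Gamk : nat -> 'M[R]_(p, J)) : Prop :=
  let L := L2 q X y lam1 lam2 lam3 alpha mu nu in
  forall k : nat,
  [/\ inD (Wk k.+1) (bk k.+1)
      /\ (forall W b, inD W b ->
           L (Wk k.+1) (bk k.+1) (Ak k) (Uk k) (Vk k) (Pik k) (Lamk k) (Gamk k)
           <= L W b (Ak k) (Uk k) (Vk k) (Pik k) (Lamk k) (Gamk k)),
      (forall A U V,
           L (Wk k.+1) (bk k.+1) (Ak k.+1) (Uk k.+1) (Vk k.+1) (Pik k) (Lamk k) (Gamk k)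
           <= L (Wk k.+1) (bk k.+1) A U V (Pik k) (Lamk k) (Gamk k)),
      Pik k.+1 = Pik k + alpha *: resid X (Wk k.+1) (bk k.+1) (Ak k.+1),
      Lamk k.+1 = Lamk k + mu *: (Wk k.+1 - Uk k.+1)
    & Gamk k.+1 = Gamk k + nu *: (Wk k.+1 - Vk k.+1)].

End MSVM.

(* Main.v *)
(* Both problems have the form: minimize f(x) + g(z) subject to x in D and z = K x, with f
   and g convex; both schemes are two-block ADMM for it. A primal minimizer exists because
   either the objective is coercive, or lam1 = lam2 = 0 and a conformal (Hoffman-type)
   decomposition bounds W without increasing the hinge loss; a multiplier then exists by
   separation, one affine constraint at a time. With a saddle point at hand, the variational
   inequalities of the two subproblems make the weighted squared distance of (u, z) to any
   saddle point decrease by the squared step, which gives convergence of the residuals and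
   of the objective values.

   For (P1) the optimality system is piecewise linear, so the same conformal decomposition
   yields a local error bound: the distance from an iterate to the set of saddle points is
   at most a constant times the last step. Hence the distance contracts geometrically, the
   increments are summable at a geometric rate, and the whole sequence converges
   R-linearly. *)
Require Import Defs.
From HB Require Import structures.
From mathcomp Require Import all_boot all_order all_algebra.
From mathcomp Require Import all_classical all_reals all_analysis.
From mathcomp Require Import ring lra.
Import Order.TTheory GRing.Theory Num.Theory.
Import numFieldNormedType.Exports.
Local Open Scope ring_scope.
Local Open Scope classical_set_scope.
Set Implicit Arguments. Unset Strict Implicit. Unset Printing Implicit Defensive.

(** * Lagrange multipliers *)

(** Multipliers need not be unique, so no single saddle point is a suitable target for a
    contraction: what shrinks is the infimum of the weighted squared distance over all saddle
    points. The decomposition serves both existence and rate because its kernel vector lies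
    coordinatewise between 0 and the given vector. Nonnegativity, signs and zero patterns are
    therefore inherited, although the decomposition itself only handles linear equations. The
    optimality system is affine, not linear, because of the constants [E], [c/n] and [lam1]. An
    extra coordinate equal to 1 makes it homogeneous; small residuals keep that coordinate above 1/2
    in the kernel vector, which can then be rescaled. This makes the error bound local, with a
    factor growing with the size of the point, so boundedness of the iterates and vanishing of the
    steps must be available before it applies. The distance only sees the second block and the dual
    variable; [W] and [b] are recovered at the end from the residual identities. *)

Section Multipliers.
Variables (R : realType) (Y : lmodType R).

Definition cvx_set (C : Y -> Prop) := forall x y (t : R),
  C x -> C y -> 0 <= t <= 1 -> C (t *: x + (1 - t) *: y).
Definition cvx_on (C : Y -> Prop) (phi : Y -> R) := forall x y (t : R),
  C x -> C y -> 0 <= t <= 1 ->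
  phi (t *: x + (1 - t) *: y) <= t * phi x + (1 - t) * phi y.
Definition affine (l : Y -> R) := forall x y (t : R),
  l (t *: x + (1 - t) *: y) = t * l x + (1 - t) * l y.

(** A segment joining the side [l < 0] to the side [l > 0] meets [l = 0], where [phi] is
    nonnegative. By convexity the slopes [phi y / l y] of the first side lie below those of the
    second, and the supremum of the lower family separates the two. *)
Lemma multiplier1 (C : Y -> Prop) (phi l : Y -> R) :
  cvx_set C -> cvx_on C phi -> affine l ->
  (exists2 y, C y & 0 < l y) -> (exists2 y, C y & l y < 0) ->
  (forall y, C y -> l y = 0 -> 0 <= phi y) ->
  exists gam, forall y, C y -> gam * l y <= phi y.
Proof.
move=> Ccvx phicvx laff [yp Cyp lyp] [yn Cyn lyn] phi0.
have cross y z : C y -> C z -> l y < 0 -> 0 < l z -> phi y / l y <= phi z / l z.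
  move=> Cy Cz ly lz.
  have d0 : 0 < l z - l y by lra.
  pose t := l z / (l z - l y).
  have t1 : 1 - t = - l y / (l z - l y) by rewrite /t; field; lra.
  have t01 : 0 <= t <= 1.
    rewrite /t ler_pdivlMr // mul0r ler_pdivrMr // mul1r; lra.
  have lt0 : l (t *: y + (1 - t) *: z) = 0 by rewrite laff t1 /t; field; lra.
  have H := le_trans (phi0 _ (Ccvx _ _ _ Cy Cz t01) lt0) (phicvx _ _ _ Cy Cz t01).
  rewrite t1 /t in H.
  rewrite ler_ndivrMr // mulrAC ler_pdivrMr //.
  have : 0 <= (l z / (l z - l y) * phi y + - l y / (l z - l y) * phi z) * (l z - l y).
    by rewrite mulr_ge0 // ltW.
  have -> : (l z / (l z - l y) * phi y + - l y / (l z - l y) * phi z) * (l z - l y)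
      = l z * phi y - l y * phi z by field; lra.
  lra.
pose A := [set v | exists2 y, C y /\ l y < 0 & v = phi y / l y].
have Aub z : C z -> 0 < l z -> ubound A (phi z / l z).
  by move=> Cz lz _ [y [Cy ly] ->]; exact: cross.
have Asup : has_sup A.
  split; first by exists (phi yn / l yn), yn.
  by exists (phi yp / l yp); exact: Aub.
exists (sup A) => y Cy.
case: (ltgtP (l y) 0) => ly.
- rewrite -ler_ndivrMr //; apply: sup_upper_bound => //; by exists y.
- rewrite -ler_pdivlMr //; apply: ge_sup; [by case: Asup|exact: Aub].
- by rewrite ly mulr0 phi0.
Qed.

(** The induction hypothesis is used on the slice [l i0 = 0]; its combination is subtracted from
    [phi], and [multiplier1] then absorbs [l i0]. Joint surjectivity plays the role of a Slater
    condition: it passes to slices and puts points on both sides of each constraint. *)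
Lemma multipliers (I : eqType) (r : seq I) (C : Y -> Prop) (phi : Y -> R)
    (l : I -> Y -> R) :
  uniq r -> cvx_set C -> cvx_on C phi -> (forall i, affine (l i)) ->
  (forall tau : I -> R, exists2 y, C y & forall i, i \in r -> l i y = tau i) ->
  (forall y, C y -> (forall i, i \in r -> l i y = 0) -> 0 <= phi y) ->
  exists gam : I -> R, forall y, C y -> \sum_(i <- r) gam i * l i y <= phi y.
Proof.
elim: r C phi => [|i0 r IH] C phi.
  move=> _ _ _ _ _ phi0; exists (fun=> 0) => y Cy; rewrite big_nil; exact: phi0.
move=> /= /andP[i0r ru] Ccvx phicvx laff lsurj phi0.
have [| | | |y Cy h|gam gamP] := IH (fun y => C y /\ l i0 y = 0) phi ru.
- move=> x y t [Cx lx] [Cy ly] t01; split; first exact: Ccvx.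
  by rewrite laff lx ly !mulr0 addr0.
- by move=> x y t [Cx _] [Cy _]; exact: phicvx.
- exact: laff.
- move=> tau.
  have [y Cy ly] := lsurj (fun i => if i == i0 then 0 else tau i).
  exists y; first by split=> //; rewrite ly ?mem_head // eqxx.
  move=> i ir; rewrite ly ?in_cons ?ir ?orbT //; case: eqP => // ii0.
  by rewrite -ii0 ir in i0r.
- case: Cy => Cy l0; apply: phi0 => // i; rewrite in_cons => /orP[/eqP->//|]; exact: h.
have [| | | |y Cy ly|g gP] :=
    @multiplier1 C (fun y => phi y - \sum_(i <- r) gam i * l i y) (l i0) Ccvx.
- move=> x y t Cx Cy t01; have := phicvx _ _ _ Cx Cy t01.
  have -> : \sum_(i <- r) gam i * l i (t *: x + (1 - t) *: y) =
     t * (\sum_(i <- r) gam i * l i x) + (1 - t) * (\sum_(i <- r) gam i * l i y).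
    rewrite !mulr_sumr -big_split /=; apply: eq_bigr => i _; rewrite laff; ring.
  lra.
- exact: laff.
- by have [y Cy ly] := lsurj (fun=> 1); exists y => //; rewrite ly ?mem_head.
- by have [y Cy ly] := lsurj (fun=> -1); exists y => //; rewrite ly ?mem_head //; lra.
- by rewrite subr_ge0; apply: gamP.
exists (fun i => if i == i0 then g else gam i) => y Cy.
rewrite big_cons eqxx -lerBrDr; apply: le_trans (gP _ Cy) _.
rewrite lerD2l lerN2 le_eqVlt; apply/orP; left; apply/eqP.
apply: eq_big_seq => i ir; case: eqP => // ii0; by rewrite -ii0 ir in i0r.
Qed.

End Multipliers.

(** * Minimization over boxes *)

Section Box.
Variables (R : realType) (I : finType).
Implicit Types (h : (I -> R) -> R).

(** Reading functions off row vectors gives access to compact boxes and extreme values while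
    variables stay indexed by sums and products of finite types. *)
Definition ofrow (w : 'rV[R]_#|I|) : I -> R := fun i => w 0 (enum_rank i).
Definition contI h := continuous (fun w : 'rV[R]_#|I| => h (ofrow w) : R).

Lemma ofrowK (t : I -> R) : ofrow (\row_k t (enum_val k)) = t.
Proof. by apply/funext => i; rewrite /ofrow mxE enum_rankK. Qed.

Lemma contI_coord i : contI (fun t => t i).
Proof. exact: coord_continuous. Qed.

Lemma contI_cst (a : R) : contI (fun=> a).
Proof. exact: cst_continuous. Qed.

Lemma contI_add h1 h2 : contI h1 -> contI h2 -> contI (fun t => h1 t + h2 t).
Proof. by move=> c1 c2 w; exact: (cvgD (c1 w) (c2 w)). Qed.

Lemma contI_mul h1 h2 : contI h1 -> contI h2 -> contI (fun t => h1 t * h2 t).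
Proof. by move=> c1 c2 w; exact: (cvgM (c1 w) (c2 w)). Qed.

Lemma contI_opp h : contI h -> contI (fun t => - h t).
Proof. by move=> c w; exact: (cvgN (c w)). Qed.

Lemma contI_norm h : contI h -> contI (fun t => `|h t|).
Proof. by move=> c w; exact: (cvg_norm (c w)). Qed.

Lemma contI_max h1 h2 : contI h1 -> contI h2 -> contI (fun t => Num.max (h1 t) (h2 t)).
Proof. by move=> c1 c2 w; exact: (continuous_max (c1 w) (c2 w)). Qed.

Lemma contI_sqrt h : contI h -> contI (fun t => Num.sqrt (h t)).
Proof. by move=> c w; exact: (continuous_comp (c w) (@sqrt_continuous R _)). Qed.

Lemma contI_sum (T : finType) (h : T -> (I -> R) -> R) :
  (forall j, contI (h j)) -> contI (fun t => \sum_j h j t).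
Proof.
move=> c.
elim: (index_enum T) => [|j r IH].
  have -> : (fun t => \sum_(j <- [::]) h j t) = (fun=> 0 : R).
    by apply/funext => t; rewrite big_nil.
  exact: contI_cst.
have -> : (fun t => \sum_(j <- j :: r) h j t) = (fun t => h j t + \sum_(j <- r) h j t).
  by apply/funext => t; rewrite big_cons.
exact: contI_add.
Qed.

Lemma contI_bigmax (T : finType) (h : T -> (I -> R) -> R) :
  (forall j, contI (h j)) -> contI (fun t => \big[Num.max/0]_j h j t).
Proof.
move=> c.
elim: (index_enum T) => [|j r IH].
  have -> : (fun t => \big[Num.max/0]_(j <- [::]) h j t) = (fun=> 0 : R).
    by apply/funext => t; rewrite big_nil.
  exact: contI_cst.
have -> : (fun t => \big[Num.max/0]_(j <- j :: r) h j t)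
    = (fun t => Num.max (h j t) (\big[Num.max/0]_(j <- r) h j t)).
  by apply/funext => t; rewrite big_cons.
exact: contI_max.
Qed.

Lemma box_EVT (T : Type) h (g : T -> (I -> R) -> R) (B : R) :
  contI h -> (forall o, contI (g o)) ->
  (exists t, (forall o, 0 <= g o t) /\ (forall i, `|t i| <= B)) ->
  exists t, [/\ forall o, 0 <= g o t, forall i, `|t i| <= B &
    forall s, (forall o, 0 <= g o s) -> (forall i, `|s i| <= B) -> h t <= h s].
Proof.
move=> hc gc [t0 [gt0 Bt0]].
pose A := [set w : 'rV[R]_#|I| | forall j, `[-B, B]%classic (w 0 j)]
  `&` \bigcap_(o in setT) [set w | 0 <= g o (ofrow w)].
have memA t : (forall o, 0 <= g o t) -> (forall i, `|t i| <= B) ->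
    A (\row_k t (enum_val k)).
  move=> gt Bt; split=> [j|o _] /=; last by rewrite ofrowK.
  by rewrite /= mxE in_itv /= -ler_norml.
have Acpt : compact A.
  apply: compact_closedI.
    by apply: (rV_compact (A := fun=> `[-B, B]%classic)) => i; exact: segment_compact.
  apply: closed_bigI => o _.
  apply: (@preimage_closed _ _ (fun w => g o (ofrow w)) [set x | 0 <= x]).
    by move=> w _; exact: gc.
  exact: closed_ge.
have [||c cA cmin] := EVT_min_rV _ Acpt (f := fun w => h (ofrow w)).
- by exists (\row_k t0 (enum_val k)); exact: memA.
- exact: continuous_subspaceT.
exists (ofrow c); move: cA; rewrite inE => -[cB cg]; split.
- by move=> o; exact: cg.
- by move=> i; have := cB (enum_rank i); rewrite /= in_itv /= -ler_norml.
- move=> s gs Bs; have := cmin (\row_k s (enum_val k)); rewrite ofrowK; apply.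
  by rewrite inE; exact: memA.
Qed.

End Box.

(** * Conformal decomposition *)

Section Cone.
Variables (R : realType) (I O : finType).

Definition linfam (ell : O -> (I -> R) -> R) := forall o a s t,
  ell o (fun i => a * s i + t i) = a * ell o s + ell o t.

Definition linsize (ell : O -> (I -> R) -> R) t := \sum_o `|ell o t|.

Variable (ell : O -> (I -> R) -> R).
Hypothesis ellP : linfam ell.

Lemma ell0 o : ell o (fun=> 0) = 0.
Proof.
have := ellP o 1 (fun=> 0) (fun=> 0).
have -> : (fun i : I => 1 * 0 + 0) = (fun=> 0 : R) by apply/funext => i; rewrite mulr0 addr0.
lra.
Qed.

Lemma ell_expand o t : ell o t = \sum_i t i * ell o (fun j => (j == i)%:R).
Proof.
have E r : ell o (fun j => \sum_(i <- r) t i * (j == i)%:R)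
    = \sum_(i <- r) t i * ell o (fun j => (j == i)%:R).
  elim: r => [|i r IH].
    rewrite big_nil -[RHS](ell0 o); congr ell; apply/funext => j; exact: big_nil.
  rewrite big_cons -IH -ellP; congr ell; apply/funext => j; exact: big_cons.
rewrite -E; congr ell; apply/funext => j.
rewrite (bigD1 j) //= eqxx mulr1 big1 ?addr0 // => i ij.
by rewrite eq_sym (negPf ij) mulr0.
Qed.

Lemma linsize_cont : contI (linsize ell).
Proof.
apply: contI_sum => o; apply: contI_norm.
have -> : ell o = (fun t => \sum_i t i * ell o (fun j => (j == i)%:R)).
  by apply/funext => t; exact: ell_expand.
apply: contI_sum => i; apply: contI_mul; [exact: contI_coord|exact: contI_cst].
Qed.

Lemma linsize_ge0 t : 0 <= linsize ell t.
Proof. by rewrite sumr_ge0. Qed.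

Lemma linsizeZ a t : linsize ell (fun i => a * t i) = `|a| * linsize ell t.
Proof.
rewrite /linsize mulr_sumr; apply: eq_bigr => o _; rewrite -normrM; congr `|_|.
rewrite -[RHS]addr0 -(ell0 o) -ellP; congr ell.
by apply/funext => i; rewrite addr0.
Qed.

Lemma linsize_eq0 t : linsize ell t = 0 -> forall o, ell o t = 0.
Proof.
move=> /eqP; rewrite psumr_eq0 // => /allP h o.
by have /implyP/(_ isT) := h o (mem_index_enum o); rewrite normr_eq0 => /eqP.
Qed.

Definition supported (S : {set I}) (t : I -> R) := forall i, i \notin S -> t i = 0.

(* Either the cone over S contains a kernel vector, which can be subtracted
   until a coordinate vanishes, or the norm of the image is bounded below on the
   compact simplex spanned by S. *)
Lemma nonneg_decomp (S : {set I}) : exists kap : R, forall t,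
  (forall i, 0 <= t i) -> supported S t -> exists k : I -> R,
  [/\ forall i, 0 <= k i <= t i, forall o, ell o k = 0 &
      forall i, t i - k i <= kap * linsize ell t].
Proof.
have [n] := ubnP #|S|; elim: n S => // n IH S Sn.
have [[v [v0 vS [j vj] vker]]|noker] := pselect (exists v : I -> R,
  [/\ forall i, 0 <= v i, supported S v, exists j, 0 < v j & forall o, ell o v = 0]).
- have step i : exists kap : R, i \in S -> forall t, (forall i, 0 <= t i) -> supported (S :\ i) t ->
      exists k : I -> R, [/\ forall i, 0 <= k i <= t i, forall o, ell o k = 0 &
      forall i, t i - k i <= kap * linsize ell t].
    case: (boolP (i \in S)) => iS; last by exists 0.
    have [|kap kapP] := IH (S :\ i).
      by rewrite (cardsD1 i) iS in Sn.
    by exists kap.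
  have {step} [kap kapP] := choice step.
  (* The coordinate that will vanish depends on [t]; the sum dominates the constant of every smaller
     face. *)
  exists (\sum_i `|kap i|) => t t0 tS.
  have [i vi imin] : exists2 i, 0 < v i & forall i', 0 < v i' -> t i / v i <= t i' / v i'.
    pose i := [arg min_(i < j | 0 < v i) t i / v i]%O.
    exists i; rewrite /i; first by case: arg_minP.
    by case: arg_minP.
  have iS : i \in S by apply: contraLR vi => /vS ->; rewrite ltxx.
  (* Ratio test: by the choice of [i], [th] is the largest multiple of [v] that can be subtracted
     with a nonnegative result, and coordinate [i] becomes 0. *)
  pose th := t i / v i; pose t1 i' := t i' - th * v i'.
  have th0 : 0 <= th by rewrite divr_ge0 // ltW.
  have t10 i' : 0 <= t1 i'.
    rewrite subr_ge0; have := v0 i'; rewrite le_eqVlt => /orP[/eqP <-|vi'].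
      by rewrite mulr0.
    by rewrite -ler_pdivlMr //; exact: imin.
  have t1S : supported (S :\ i) t1.
    move=> i'; rewrite !inE negb_and negbK => /orP[/eqP ->|i'S].
      by rewrite /t1 /th divfK ?subrr // gt_eqF.
    by rewrite /t1 tS // vS // mulr0 subr0.
  have ellt1 o : ell o t1 = ell o t.
    have := ellP o (- th) v t; rewrite vker mulr0 add0r => <-; congr ell.
    by apply/funext => i'; rewrite /t1; ring.
  have Nt1 : linsize ell t1 = linsize ell t by apply: eq_bigr => o _; rewrite ellt1.
  have [k [k01 kker kle]] := kapP i iS t1 t10 t1S.
  exists (fun i' => th * v i' + k i'); split.
  + move=> i'; have /andP[k0 k1] := k01 i'; have := k1; rewrite /t1.
    have : 0 <= th * v i' by rewrite mulr_ge0.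
    lra.
  + by move=> o; rewrite ellP vker kker mulr0 addr0.
  + move=> i'; have := kle i'; rewrite Nt1 => h.
    have : kap i * linsize ell t <= (\sum_i `|kap i|) * linsize ell t.
      rewrite ler_wpM2r ?linsize_ge0 // (bigD1 i) //=.
      by apply: le_trans (ler_norm _) _; rewrite lerDl sumr_ge0.
    rewrite /t1 in h; lra.
- have [/existsP[j jS]|/existsPn Semp] := boolP [exists j, j \in S]; last first.
    exists 0 => t t0 tS; exists (fun=> 0); split => [i|o|i].
    + by rewrite lexx t0.
    + exact: ell0.
    + by rewrite mul0r subr0 tS // Semp.
  (* For [t >= 0], a nonpositive sum off [S] forces the support into [S]. Asking for total mass at
     least 1 excludes 0 and keeps every vector normalized to mass 1. *)
  pose g (o : I + bool) (t : I -> R) := match o with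
    | inl i => t i
    | inr true => - \sum_(i | i \notin S) t i
    | inr false => \sum_i t i - 1 end.
  have gP t : (forall o, 0 <= g o t) ->
    [/\ forall i, 0 <= t i, supported S t & 1 <= \sum_i t i].
    move=> h; have t0 i : 0 <= t i := h (inl i).
    split => //; last by have := h (inr false) => /=; rewrite subr_ge0.
    move=> i iS; have := h (inr true) => /=; rewrite oppr_ge0 (bigD1 i) //=.
    have : 0 <= \sum_(i0 | (i0 \notin S) && (i0 != i)) t i0 by rewrite sumr_ge0.
    have := t0 i; lra.
  have [| |c [gc Bc cmin]] := @box_EVT R I _ (linsize ell) g 1 linsize_cont.
  - case=> [i|[]]; first exact: contI_coord.
      have -> : g (inr true)
          = (fun t => - \sum_i (if i \notin S then 1 else 0) * t i).
        apply/funext => t; rewrite /g big_mkcond; congr (- _); apply: eq_bigr => i _.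
        by case: ifP; rewrite ?mul1r ?mul0r.
      apply: contI_opp; apply: contI_sum => i; apply: contI_mul; first exact: contI_cst.
      exact: contI_coord.
    apply: contI_add; last exact: contI_cst.
    by apply: contI_sum => i; exact: contI_coord.
  - exists (fun i => (i == j)%:R); split; last by move=> i; case: eqP; rewrite ?normr1 ?normr0.
    case=> [i|[]] /=; first by rewrite ler0n.
      rewrite big1 ?oppr0 // => i; by case: eqP => // ->; rewrite jS.
    by rewrite (bigD1 j) //= eqxx big1 ?addr0 ?subrr // => i /negPf ->.
  have [c0 cS c1] := gP _ gc.
  have Nc : 0 < linsize ell c.
    rewrite lt_neqAle linsize_ge0 andbT eq_sym; apply/negP => /eqP /linsize_eq0 cker.
    apply: noker; exists c; split => //; apply/not_existsP => h.
    have : \sum_i c i <= 0 by apply: sumr_le0 => i _; rewrite leNgt; apply/negP/h.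
    lra.
  (* Here nothing is subtracted: the minimum of [linsize] is positive, and by homogeneity it bounds
     the mass of [t]. *)
  exists (linsize ell c)^-1 => t t0 tS; exists (fun=> 0); split => [i|o|i].
  + by rewrite lexx t0.
  + exact: ell0.
  + rewrite subr0 mulrC ler_pdivlMr //.
    have ti : t i <= \sum_i t i by rewrite (bigD1 i) //= lerDl sumr_ge0.
    apply: (@le_trans _ _ ((\sum_i t i) * linsize ell c)).
      by rewrite ler_wpM2r // ltW.
    have : 0 <= \sum_i t i by rewrite sumr_ge0.
    rewrite le_eqVlt => /orP[/eqP <-|s0]; first by rewrite mul0r linsize_ge0.
    have := cmin (fun i => (\sum_i t i)^-1 * t i).
    rewrite linsizeZ gtr0_norm ?invr_gt0 // mulrC ler_pdivlMr // mulrC; apply.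
    * case=> [i'|[]] /=; first by rewrite mulr_ge0 // invr_ge0 ltW.
        by rewrite big1 ?oppr0 // => i' i'S; rewrite tS // mulr0.
      by rewrite -mulr_sumr mulVf ?subrr // gt_eqF.
    * move=> i'; rewrite ger0_norm ?mulr_ge0 ?invr_ge0 ?(ltW s0) //.
      rewrite mulrC ler_pdivrMr // mul1r (bigD1 i') //= lerDl sumr_ge0 //.
Qed.

End Cone.

(** Positive and negative parts are treated as separate nonnegative variables. At each index one of
    the two is 0, and so is the corresponding part of the kernel vector; this is what keeps the
    multiplier [th i] between 0 and 1. *)
Lemma conformal_decomp (R : realType) (I O : finType) (ell : O -> (I -> R) -> R) :
  linfam ell -> exists2 kap : R, 0 <= kap & forall t, exists th : I -> R,
  [/\ forall i, 0 <= th i <= 1, forall o, ell o (fun i => th i * t i) = 0 &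
      forall i, `|t i - th i * t i| <= kap * linsize ell t].
Proof.
move=> ellP.
pose e2 o (s : I * bool -> R) := ell o (fun i => s (i, true) - s (i, false)).
have e2P : linfam e2.
  move=> o a s t; rewrite /e2 -ellP; congr ell; apply/funext => i; ring.
have [kap kapP] := nonneg_decomp e2P [set: I * bool].
exists `|kap| => // t.
pose s (ib : I * bool) := if ib.2 then Num.max (t ib.1) 0 else Num.max (- t ib.1) 0.
have st i : s (i, true) - s (i, false) = t i.
  rewrite /s /= !maxEle; case: ifP; case: ifP; lra.
have [ | |k [k01 kker kle]] := kapP s.
- by move=> [i []]; rewrite /s /= le_max lexx orbT.
- by move=> i; rewrite inE.
have Ns : linsize e2 s = linsize ell t.
  by apply: eq_bigr => o _; rewrite /e2; congr (`|ell o _|); apply/funext => i; exact: st.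
rewrite Ns in kle.
(* Where [t i = 0] the quotient is 0 by convention, and both parts of [k] vanish there too, so
   multiplying back by [t i] is always correct. *)
exists (fun i => (k (i, true) - k (i, false)) / t i).
have E i : (k (i, true) - k (i, false)) / t i * t i = k (i, true) - k (i, false).
  have [ti0|ti] := eqVneq (t i) 0; last by rewrite divfK.
  have := k01 (i, true); have := k01 (i, false).
  rewrite ti0 /s /= ti0 oppr0 maxxx mulr0; lra.
split.
- move=> i; have := k01 (i, true); have := k01 (i, false); rewrite /s /=.
  case: (ltgtP (t i) 0) => ti.
  + rewrite max_l; last lra. move=> h1 h2.
    rewrite ler_ndivlMr // ler_ndivrMr //; lra.
  + rewrite max_r; last lra. move=> h1 h2.
    rewrite ler_pdivlMr // ler_pdivrMr //; lra.
  + by rewrite ti invr0 mulr0 lexx ler01.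
- move=> o; rewrite -[RHS](kker o) /e2; congr ell; apply/funext => i; exact: E.
- move=> i; rewrite E.
  have h1 := kle (i, true); have h2 := kle (i, false).
  have := k01 (i, true); have := k01 (i, false).
  have hk : kap * linsize ell t <= `|kap| * linsize ell t.
    by rewrite ler_wpM2r ?linsize_ge0 // ler_norm.
  move: h1 h2; rewrite /s /= ler_norml => h1 h2.
  have := st i; rewrite /s /=; lra.
Qed.

(** * Abstract two-block ADMM *)

Section InnerProduct.
Variables (R : realType) (Z : lmodType R).

Record inner_product (ip : Z -> Z -> R) : Prop := InnerProduct {
  ipDl : forall a b c, ip (a + b) c = ip a c + ip b c;
  ipZl : forall t a b, ip (t *: a) b = t * ip a b;
  ipC : forall a b, ip a b = ip b a;
  ip_ge0 : forall a, 0 <= ip a a }.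

Variable ip : Z -> Z -> R.
Hypothesis ipP : inner_product ip.

Lemma ipDr a b c : ip c (a + b) = ip c a + ip c b.
Proof. by rewrite ipC // ipDl // !(ipC ipP c). Qed.

Lemma ipZr t a b : ip b (t *: a) = t * ip b a.
Proof. by rewrite ipC // ipZl // (ipC ipP a). Qed.

Lemma ipNl a b : ip (- a) b = - ip a b.
Proof. by rewrite -scaleN1r ipZl // mulN1r. Qed.

Lemma ipNr a b : ip b (- a) = - ip b a.
Proof. by rewrite -scaleN1r ipZr // mulN1r. Qed.

Definition ipE := (ipDl ipP, ipDr, ipNl, ipNr, ipZl ipP, ipZr).

(** The form is only semidefinite, so [ip b b = 0] is a separate case: the quadratic in [t] is then
    affine, and being nonnegative everywhere it must be constant. *)
Lemma ip_sqr_le a b : ip a b ^+ 2 <= ip a a * ip b b.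
Proof.
have h t : 0 <= ip a a + 2 * t * ip a b + t ^+ 2 * ip b b.
  have := ip_ge0 ipP (a + t *: b); rewrite !ipE (ipC ipP b a) => /le_trans; apply.
  by rewrite le_eqVlt; apply/orP; left; apply/eqP; ring.
have := ip_ge0 ipP b; rewrite le_eqVlt => /orP[/eqP b0|b0].
  rewrite -b0 mulr0; have [->|ab] := eqVneq (ip a b) 0; first by rewrite expr0n.
  have := h (- (ip a a + 1) / (2 * ip a b)); rewrite -b0 mulr0 addr0.
  have -> : 2 * (- (ip a a + 1) / (2 * ip a b)) * ip a b = - (ip a a + 1) by field.
  lra.
have := h (- ip a b / ip b b).
have -> : ip a a + 2 * (- ip a b / ip b b) * ip a b + (- ip a b / ip b b) ^+ 2 * ip b b
   = (ip a a * ip b b - ip a b ^+ 2) / ip b b by field; rewrite gt_eqF.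
by rewrite pmulr_lge0 ?invr_gt0 // subr_ge0.
Qed.

Lemma ip_norm_le a b : `|ip a b| <= Num.sqrt (ip a a) * Num.sqrt (ip b b).
Proof.
by rewrite -sqrtr_sqr -sqrtrM ?(ip_ge0 ipP) // ler_wsqrtr // ip_sqr_le.
Qed.

Lemma ip_norm_le2 a b (A B : R) : ip a a <= A -> ip b b <= B ->
  `|ip a b| <= Num.sqrt A * Num.sqrt B.
Proof.
move=> hA hB; apply: le_trans (ip_norm_le a b) _.
by rewrite ler_pM ?sqrtr_ge0 ?ler_wsqrtr.
Qed.

Lemma first_order_ge0 (a b : R) :
  (forall t, 0 < t <= 1 -> 0 <= t * a + t ^+ 2 * b) -> 0 <= a.
Proof.
move=> h; rewrite leNgt; apply/negP => a0.
have d : 0 < - a + `|b| by have := normr_ge0 b; lra.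
(* Chosen so that [t * |b| < - a / 2]: the quadratic term cannot compensate the negative linear
   one. *)
pose t := - a / (2 * (- a + `|b|)).
have t0 : 0 < t by rewrite divr_gt0; lra.
have t1 : t <= 1 by rewrite ler_pdivrMr; have := normr_ge0 b; lra.
have := h t; rewrite t0 t1 => /(_ isT).
have -> : t * a + t ^+ 2 * b = t * (a + t * b) by ring.
rewrite pmulr_rge0 //.
have : t * b <= t * `|b| by rewrite ler_pM2l // ler_norm.
have : t * (- a + `|b|) = - a / 2 by rewrite /t; field; lra.
have : 0 < t * - a by rewrite mulr_gt0; lra.
lra.
Qed.

(** The minimizer is compared with points of the segment towards [y]. The smooth quadratic part is
    replaced by its derivative, while the possibly nonsmooth [phi] stays as a difference of
    values. *)
Lemma augmented_vi (Y : lmodType R) (C : Y -> Prop) (phi : Y -> R) (L : Y -> Z)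
    (w : Z) (y1 : Y) : cvx_set C -> cvx_on C phi ->
  (forall x y (t : R), L (t *: x + (1 - t) *: y) = t *: L x + (1 - t) *: L y) ->
  C y1 ->
  (forall y, C y -> phi y1 + ip w (L y1) + ip (L y1) (L y1) / 2
                 <= phi y + ip w (L y) + ip (L y) (L y) / 2) ->
  forall y, C y -> 0 <= phi y - phi y1 + ip (w + L y1) (L y - L y1).
Proof.
move=> Ccvx phicvx Laff Cy1 ymin y Cy.
apply: (@first_order_ge0 _ (ip (L y - L y1) (L y - L y1) / 2)) => t /andP[t0 t1].
have t01 : 0 <= t <= 1 by rewrite ltW.
have := ymin _ (Ccvx _ _ _ Cy Cy1 t01); have := phicvx _ _ _ Cy Cy1 t01.
rewrite Laff !ipE.
rewrite (ipC ipP (L y1) (L y)).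
move=> h1 h2.
set p := phi _ in h1 h2.
have := le_trans h2 (lerD (lerD h1 (lexx _)) (lexx _)).
lra.
Qed.

End InnerProduct.

Section ADMM.
Variables (R : realType) (X Z : lmodType R) (ip : Z -> Z -> R).
Hypothesis ipP : inner_product ip.
Variables (D : X -> Prop) (f : X -> R) (g : Z -> R) (K : X -> Z).
Hypothesis Dcvx : cvx_set D.
Hypothesis fcvx : cvx_on D f.
Hypothesis gcvx : cvx_on (fun=> True) g.
Hypothesis Kaff : forall x y (t : R), K (t *: x + (1 - t) *: y) = t *: K x + (1 - t) *: K y.

(* The dual variable u is scaled: with respect to ip, which carries the penalty
   parameters, the multiplier and penalty terms are ip u r and ip r r / 2. *)
Definition aug x z u :=
  f x + g z + ip u (K x - z) + ip (K x - z) (K x - z) / 2.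

(** The second block is [K s.1] by construction. Feasibility, equivalent to maximality in the
    multiplier, is thus built in, and only minimality of the Lagrangian is stated. *)
Definition saddle (s : X * Z) := D s.1 /\ forall x z, D x ->
  f s.1 + g (K s.1) <= f x + g z + ip s.2 (K x - z).

Variables (x : nat -> X) (z u : nat -> Z).
Definition admm_seq := forall k, [/\ D (x k.+1),
  forall y, D y -> aug (x k.+1) (z k) (u k) <= aug y (z k) (u k),
  forall y, aug (x k.+1) (z k.+1) (u k) <= aug (x k.+1) y (u k) &
  u k.+1 = u k + (K (x k.+1) - z k.+1)].
Hypothesis seqP : admm_seq.

Let resE k : K (x k.+1) = u k.+1 - u k + z k.+1.
Proof. by have [_ _ _ ->] := seqP k; rewrite [u k + _]addrC addrK subrK. Qed.

(** The first block is updated against the old [z k], so its multiplier differs from [u k.+1] by the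
    increment of [z]. *)
Lemma x_vi k y : D y ->
  0 <= f y - f (x k.+1) + ip (u k.+1 + (z k.+1 - z k)) (K y - K (x k.+1)).
Proof.
move=> Dy; have [Dx xmin _ _] := seqP k.
have := @augmented_vi _ _ _ ipP _ D f (fun x => K x - z k) (u k) (x k.+1) Dcvx fcvx.
have -> : u k + (K (x k.+1) - z k) = u k.+1 + (z k.+1 - z k).
  by rewrite resE -[_ + _ - z k]addrA [LHS]addrA [u k + _]addrC subrK.
have -> : K y - K (x k.+1) = K y - z k - (K (x k.+1) - z k).
  by rewrite opprB addrA subrK.
apply=> //.
- by move=> a b t; rewrite Kaff !scalerBr [RHS]addrACA -opprD -scalerDl [t + _]addrC subrK scale1r.
- move=> y' /xmin; rewrite /aug; lra.
Qed.

(** The dual update is designed for this: the new [u] is exactly a subgradient of [g] at the new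
    [z]. *)
Lemma z_vi k y : 0 <= g y - g (z k.+1) - ip (u k.+1) (y - z k.+1).
Proof.
have [_ _ zmin uE] := seqP k.
have := @augmented_vi _ _ _ ipP _ (fun=> True) g (fun z => K (x k.+1) - z) (u k) (z k.+1)
  (fun _ _ _ _ _ _ => I) gcvx.
rewrite -uE -(ipNr ipP).
have -> : - (y - z k.+1) = K (x k.+1) - y - (K (x k.+1) - z k.+1).
  by rewrite !opprB [RHS]addrC addrA subrK.
apply=> //.
- move=> a b t; rewrite !scalerBr [RHS]addrACA -scalerDl [t + _]addrC subrK scale1r.
  by rewrite opprD.
- by move=> y' _; have := zmin y'; rewrite /aug; lra.
Qed.

Let V (s : X * Z) k := ip (u k - s.2) (u k - s.2) + ip (z k - K s.1) (z k - K s.1).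

Definition step_size k := ip (u k.+1 - u k) (u k.+1 - u k) + ip (z k.+1 - z k) (z k.+1 - z k).

Lemma value_upper (s : X * Z) k : saddle s ->
  f (x k.+1) + g (z k.+1) - (f s.1 + g (K s.1)) <=
  - ip (u k.+1) (u k.+1 - u k)
  + ip (z k.+1 - z k) (K s.1 - z k.+1 - (u k.+1 - u k)).
Proof.
move=> [Ds _]; have := x_vi k Ds; have := z_vi k (K s.1).
rewrite resE !(ipE ipP); lra.
Qed.

Lemma value_lower (s : X * Z) k : saddle s ->
  f s.1 + g (K s.1) <= f (x k.+1) + g (z k.+1) + ip s.2 (u k.+1 - u k).
Proof.
move=> [_ sP]; have [Dx _ _ _] := seqP k; have := sP _ (z k.+1) Dx.
by rewrite resE addrK.
Qed.

(** The upper and lower value estimates leave a cross term between the increments of [u] and [z].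
    Its sign comes from monotonicity of the subdifferential of [g], the sum of [h3] and [h4].
    Indices start at 1 because [u 0] is arbitrary and need not be a subgradient at [z 0]. *)
Lemma fejer (s : X * Z) k : saddle s -> V s k.+2 + step_size k.+1 <= V s k.+1.
Proof.
move=> sP; have h1 := value_upper k.+1 sP; have h2 := value_lower k.+1 sP.
have h3 := z_vi k.+1 (z k.+1); have h4 := z_vi k (z k.+2).
move: h1 h2 h3 h4; rewrite /V /step_size !(ipE ipP).
rewrite !(ipC ipP (u k.+1) (u k.+2)) !(ipC ipP (z k.+1) (z k.+2)).
rewrite !(ipC ipP s.2) !(ipC ipP (K s.1)) !(ipC ipP (u _) (z _)).
lra.
Qed.

Lemma V_ge0 s k : 0 <= V s k.
Proof. by rewrite addr_ge0 // (ip_ge0 ipP). Qed.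

Lemma step_ge0 k : 0 <= step_size k.
Proof. by rewrite addr_ge0 // (ip_ge0 ipP). Qed.

Lemma V_bounded s k : saddle s -> V s k.+1 <= V s 1.
Proof.
move=> sP; elim: k => // k IH; apply: le_trans IH.
by have := fejer k sP; have := step_ge0 k.+1; lra.
Qed.

Lemma step_cvg0 s : saddle s -> step_size k @[k --> \oo] --> (0 : R).
Proof.
move=> sP; rewrite -(cvg_shiftS step_size).
have Vcvg : cvgn (fun k => V s k.+1).
  apply: nonincreasing_is_cvgn; last by exists 0 => _ [k _ <-]; exact: V_ge0.
  apply/nonincreasing_seqP => k.
  by have := fejer k sP; have := step_ge0 k.+1; lra.
have h : V s k.+1 - V s k.+2 @[k --> \oo] --> (0 : R).
  rewrite -(subrr (limn (fun k => V s k.+1))); apply: cvgB => //.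
  by rewrite (cvg_shiftS (fun k => V s k.+1)).
apply: (squeeze_cvgr _ (cvg_cst 0) h); near=> k.
by rewrite step_ge0 /=; have := fejer k sP; lra.
Unshelve. all: by end_near.
Qed.

Lemma admm_residual s : saddle s ->
  ip (K (x k) - z k) (K (x k) - z k) @[k --> \oo] --> (0 : R).
Proof.
move=> sP; rewrite -(cvg_shiftS (fun k => ip (K (x k) - z k) (K (x k) - z k))).
apply: (squeeze_cvgr _ (cvg_cst 0) (step_cvg0 sP)); near=> k.
rewrite (ip_ge0 ipP) /= resE addrK /step_size lerDl (ip_ge0 ipP) //.
Unshelve. all: by end_near.
Qed.

Lemma admm_value s : saddle s ->
  f (x k) + g (z k) @[k --> \oo] --> f s.1 + g (K s.1).
Proof.
move=> sP.
pose b : R := Num.sqrt (V s 1); pose a : R := Num.sqrt (ip s.2 s.2).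
pose e k : R := Num.sqrt (step_size k.+1).
have e0 : e k @[k --> \oo] --> (0 : R).
  rewrite -sqrtr0; apply: (continuous_cvg _ (@sqrt_continuous R _)).
  by rewrite (cvg_shiftS step_size); exact: step_cvg0 sP.
(* Cauchy-Schwarz on the value estimates: one [b] each for the distances of [u] and [z] to the
   saddle point, [a] for the multiplier itself, and [e k] for the product of the two increments. *)
pose E k : R := (2 * b + a + e k) * e k.
have E0 : E k @[k --> \oo] --> (0 : R).
  rewrite -(mulr0 (2 * b + a + 0)); apply: cvgM => //.
  by apply: cvgD => //; exact: cvg_cst.
rewrite -(cvg_shiftS (fun k => f (x k) + g (z k))).
rewrite -(cvg_shiftS (fun k => f (x k.+1) + g (z k.+1))).
apply: (@squeeze_cvgr _ _ _ _ (fun k => f s.1 + g (K s.1) - E k)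
  (fun k => f s.1 + g (K s.1) + E k)).
- near=> k.
  have h1 := value_upper k.+1 sP; have h2 := value_lower k.+1 sP.
  have su : ip (u k.+2 - u k.+1) (u k.+2 - u k.+1) <= step_size k.+1.
    by rewrite lerDl (ip_ge0 ipP).
  have sz : ip (z k.+2 - z k.+1) (z k.+2 - z k.+1) <= step_size k.+1.
    by rewrite lerDr (ip_ge0 ipP).
  have Vk := V_bounded k.+1 sP.
  have bu : ip (u k.+2 - s.2) (u k.+2 - s.2) <= V s 1.
    by apply: le_trans Vk; rewrite lerDl (ip_ge0 ipP).
  have bz : ip (z k.+2 - K s.1) (z k.+2 - K s.1) <= V s 1.
    by apply: le_trans Vk; rewrite lerDr (ip_ge0 ipP).
  have := ip_norm_le2 ipP bu su; have := ip_norm_le2 ipP bz sz.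
  have := ip_norm_le2 ipP (lexx (ip s.2 s.2)) su; have := ip_norm_le2 ipP sz su.
  rewrite -/(e k) -/a -/b !ler_norml.
  have ee : 0 <= e k by rewrite sqrtr_ge0.
  have b0 : 0 <= b by rewrite sqrtr_ge0.
  have := mulr_ge0 ee ee; have := mulr_ge0 b0 ee.
  move: h1 h2; rewrite /E !(ipE ipP) !(ipC ipP (K s.1)).
  rewrite !(ipC ipP (z k.+1) (z k.+2)). by move=> *; apply/andP; split => /=; lra.
- by rewrite -[X in _ --> X]subr0; apply: cvgB => //; exact: cvg_cst.
- by rewrite -[X in _ --> X]addr0; apply: cvgD => //; exact: cvg_cst.
Unshelve. all: by end_near.
Qed.

(** The error bound gives [dst k.+2 <= kap * step_size k.+1], while [fejer] bounds
    [dst k.+2 + step_size k.+1] by [V s' k.+1] for every saddle point [s']. Eliminating the step and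
    taking the infimum over [s'] yields the ratio [kap / (kap + 1)]. *)
Lemma admm_linear (s0 : X * Z) (kap : R) (N : nat) : saddle s0 -> 0 < kap ->
  (forall k, (N <= k)%N -> exists2 s, saddle s & V s k.+2 <= kap * step_size k.+1) ->
  exists C r : R, 0 < r < 1 /\ forall k, step_size (N + k).+1 <= C * r ^+ k.
Proof.
move=> s0P kap0 err.
pose dst k := inf [set v | exists2 s, saddle s & v = V s k].
have hinf k : has_inf [set v | exists2 s, saddle s & v = V s k].
  split; first by exists (V s0 k), s0.
  by exists 0 => _ [s _ ->]; exact: V_ge0.
have dstP s k : saddle s -> dst k <= V s k.
  by move=> sP; apply: (ge_inf (hinf k).2); exists s.
have le_dst c k : (forall s, saddle s -> c <= V s k) -> c <= dst k.
  by move=> h; apply: lb_le_inf; [exact: (hinf k).1|move=> _ [s sP ->]; exact: h].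
have step_dst k : step_size k.+1 <= dst k.+1.
  apply: le_dst => s sP; have := fejer k sP; have := V_ge0 s k.+2; lra.
have contr k : (N <= k)%N -> dst k.+2 <= kap / (kap + 1) * dst k.+1.
  move=> Nk; have [s sP sV] := err k Nk.
  have h : dst k.+2 <= kap * step_size k.+1 := le_trans (dstP _ _ sP) sV.
  have : dst k.+2 * (kap + 1) / kap <= dst k.+1.
    apply: le_dst => s' s'P; rewrite ler_pdivrMr //.
    have := fejer k s'P; have := dstP _ k.+2 s'P.
    nra.
  have k1 : 0 < kap + 1 by lra.
  by rewrite ler_pdivrMr // [kap / _ * _]mulrAC ler_pdivlMr // [dst k.+1 * _]mulrC.
exists (dst N.+1), (kap / (kap + 1)); split.
  rewrite divr_gt0 ?ltr_pdivrMr /=; lra.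
move=> k; apply: le_trans (step_dst _) _.
elim: k => [|k IH]; first by rewrite addn0 expr0 mulr1.
rewrite addnS; apply: le_trans (contr _ _) _; first by rewrite leq_addr.
rewrite exprS mulrCA ler_pM2l //; rewrite divr_gt0; lra.
Qed.

End ADMM.

(** * Existence of saddle points *)

Section Coordinates.
Variables (R : realType).

(** Finite dimension in the form needed for duality: the coordinates are the scalar constraints
    given to [multipliers], and the last clause is a Riesz representation that assembles their
    multipliers into one dual vector. *)
Definition coordinatized (Z : lmodType R) (ip : Z -> Z -> R) :=
  exists (I : finType) (co : I -> Z -> R),
  [/\ forall i t x y, co i (t *: x + y) = t * co i x + co i y,
      forall tau : I -> R, exists z, forall i, co i z = tau i,
      forall z, (forall i, co i z = 0) -> z = 0 &
      forall gam : I -> R, exists u, forall z, ip u z = \sum_i gam i * co i z].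

Definition pair_ip (Z1 Z2 : lmodType R) (ip1 : Z1 -> Z1 -> R) (ip2 : Z2 -> Z2 -> R)
  (z w : Z1 * Z2) : R := ip1 z.1 w.1 + ip2 z.2 w.2.

Lemma pair_ipP (Z1 Z2 : lmodType R) (ip1 : Z1 -> Z1 -> R) (ip2 : Z2 -> Z2 -> R) :
  inner_product ip1 -> inner_product ip2 -> inner_product (pair_ip ip1 ip2).
Proof.
move=> h1 h2; split; rewrite /pair_ip /=.
- by move=> a b c; rewrite (ipDl h1) (ipDl h2) addrACA.
- by move=> t a b; rewrite (ipZl h1) (ipZl h2) mulrDr.
- by move=> a b; rewrite (ipC h1) (ipC h2).
- by move=> a; rewrite addr_ge0 ?(ip_ge0 h1) ?(ip_ge0 h2).
Qed.

Lemma pair_coordinatized (Z1 Z2 : lmodType R) (ip1 : Z1 -> Z1 -> R) (ip2 : Z2 -> Z2 -> R) :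
  coordinatized ip1 -> coordinatized ip2 -> coordinatized (pair_ip ip1 ip2).
Proof.
move=> [I1 [co1 [l1 s1 i1 r1]]] [I2 [co2 [l2 s2 i2 r2]]].
exists (I1 + I2)%type.
exists (fun i (z : Z1 * Z2) => match i with inl i => co1 i z.1 | inr i => co2 i z.2 end); split.
- by case=> i t x y /=; [exact: l1|exact: l2].
- move=> tau; have [z1 h1] := s1 (tau \o inl); have [z2 h2] := s2 (tau \o inr).
  by exists (z1, z2); case=> i /=; [exact: h1|exact: h2].
- move=> [z1 z2] h; congr pair; first by apply: i1 => i; exact: (h (inl i)).
  by apply: i2 => i; exact: (h (inr i)).
- move=> gam; have [u1 h1] := r1 (gam \o inl); have [u2 h2] := r2 (gam \o inr).
  by exists (u1, u2) => z; rewrite big_sumType /pair_ip /= h1 h2.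
Qed.

Lemma innerE m k (P Q : 'M[R]_(m, k)) : inner P Q = \sum_i \sum_j P i j * Q i j.
Proof.
rewrite /inner /mxtrace exchange_big; apply: eq_bigr => j _; rewrite mxE.
by apply: eq_bigr => i _; rewrite mxE.
Qed.

Lemma frob2E m k (P : 'M[R]_(m, k)) : frob2 P = inner P P.
Proof. by rewrite innerE; apply: eq_bigr => i _; apply: eq_bigr => j _; rewrite expr2. Qed.

Lemma frob2_ge0 m k (P : 'M[R]_(m, k)) : 0 <= frob2 P.
Proof. by apply: sumr_ge0 => i _; apply: sumr_ge0 => j _; exact: sqr_ge0. Qed.

Lemma inner_mxP m k : inner_product (@inner R m k).
Proof.
split.
- by move=> a b c; rewrite /inner linearD /= mulmxDl linearD.
- by move=> t a b; rewrite /inner linearZ /= -scalemxAl linearZ.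
- by move=> a b; rewrite !innerE; apply: eq_bigr => i _; apply: eq_bigr => j _; rewrite mulrC.
- by move=> a; rewrite -frob2E frob2_ge0.
Qed.

Definition wip m k (a : R) (P Q : 'M[R]_(m, k)) : R := a * inner P Q.

Lemma wipP m k (a : R) : 0 < a -> inner_product (@wip m k a).
Proof.
move=> a0; split; rewrite /wip.
- by move=> x y c; rewrite (ipDl (inner_mxP _ _)) mulrDr.
- by move=> t x y; rewrite (ipZl (inner_mxP _ _)) mulrCA.
- by move=> x y; rewrite (ipC (inner_mxP _ _)).
- by move=> x; rewrite mulr_ge0 ?(ip_ge0 (inner_mxP _ _)) // ltW.
Qed.

Lemma wip_coordinatized m k (a : R) : 0 < a -> coordinatized (@wip m k a).
Proof.
move=> a0; exists ('I_m * 'I_k)%type, (fun ij (M : 'M[R]_(m, k)) => M ij.1 ij.2); split.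
- by move=> [i j] t x y; rewrite !mxE.
- by move=> tau; exists (\matrix_(i, j) tau (i, j)) => -[i j]; rewrite mxE.
- by move=> z h; apply/matrixP => i j; rewrite mxE; exact: (h (i, j)).
- move=> gam; exists (\matrix_(i, j) (gam (i, j) / a)) => z.
  rewrite /wip innerE pair_big /= mulr_sumr; apply: eq_bigr => -[i j] _ /=.
  by rewrite mxE; field; rewrite gt_eqF.
Qed.

(** The constraint [K x = z] is dualized on pairs [(x, z)]. As [z] is free, the coordinates of
    [K x - z] take arbitrary values already at [x = xs], which is the surjectivity required. *)
Lemma saddle_exists (X Z : lmodType R) (ip : Z -> Z -> R) (D : X -> Prop)
    (f : X -> R) (g : Z -> R) (K : X -> Z) (xs : X) :
  coordinatized ip -> inner_product ip -> cvx_set D -> cvx_on D f -> cvx_on (fun=> True) g ->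
  (forall x y (t : R), K (t *: x + (1 - t) *: y) = t *: K x + (1 - t) *: K y) ->
  D xs -> (forall x, D x -> f xs + g (K xs) <= f x + g (K x)) ->
  exists us, saddle ip D f g K (xs, us).
Proof.
move=> [I [co [col cos coi cor]]] ipP Dcvx fcvx gcvx Kaff Dxs xsmin.
have coB i a b : co i (a - b) = co i a - co i b.
  by rewrite -scaleN1r addrC col; ring.
have [| | | | | |gam gamP] := @multipliers R (X * Z)%type I (index_enum I) (fun y => D y.1)
  (fun y => f y.1 + g y.2 - (f xs + g (K xs))) (fun i y => co i (K y.1 - y.2)).
- exact: index_enum_uniq.
- by move=> [x1 z1] [x2 z2] t /= Dx1 Dx2 t01; exact: Dcvx.
- move=> [x1 z1] [x2 z2] t /= Dx1 Dx2 t01.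
  have := fcvx _ _ _ Dx1 Dx2 t01; have := gcvx z1 z2 t Logic.I Logic.I t01; lra.
- move=> i [x1 z1] [x2 z2] t /=; rewrite Kaff.
  have -> : t *: K x1 + (1 - t) *: K x2 - (t *: z1 + (1 - t) *: z2)
     = t *: (K x1 - z1) + ((1 - t) *: (K x2 - z2) + 0).
    by rewrite addr0 !scalerBr [RHS]addrACA -opprD.
  rewrite !col.
  have -> : co i 0 = 0 by rewrite -(subrr (K xs)) coB subrr.
  by rewrite addr0.
- move=> tau; have [z zP] := cos tau; exists (xs, K xs - z) => //= i _.
  by rewrite subKr.
- move=> [x z] /= Dx h.
  have /eqP := coi (K x - z) (fun i => h i (mem_index_enum i)).
  rewrite subr_eq0 => /eqP <-; rewrite subr_ge0; exact: xsmin.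
have [u uP] := cor (fun i => - gam i).
exists u; split => // x z Dx /=.
have := gamP (x, z) Dx; rewrite uP /=.
have -> : \sum_i - gam i * co i (K x - z) = - \sum_i gam i * co i (K x - z).
  by rewrite -sumrN; apply: eq_bigr => i _; rewrite mulNr.
lra.
Qed.

End Coordinates.

(** * Convexity of the losses and norms *)

Section Convexity.
Variables (R : realType).

Definition convex_fun (Y : lmodType R) (phi : Y -> R) := cvx_on (fun=> True) phi.

Lemma cvx_restr (Y : lmodType R) (C : Y -> Prop) (phi : Y -> R) :
  convex_fun phi -> cvx_on C phi.
Proof. by move=> h x y t _ _; exact: h. Qed.

Lemma convex_add (Y : lmodType R) (phi psi : Y -> R) :
  convex_fun phi -> convex_fun psi -> convex_fun (fun y => phi y + psi y).
Proof.
by move=> h1 h2 x y t _ _ t01; have := h1 x y t I I t01; have := h2 x y t I I t01; lra.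
Qed.

Lemma convex_scale (Y : lmodType R) (a : R) (phi : Y -> R) : 0 <= a ->
  convex_fun phi -> convex_fun (fun y => a * phi y).
Proof.
move=> a0 h x y t _ _ t01; have := ler_wpM2l a0 (h x y t I I t01); lra.
Qed.

Lemma convex_sum (Y : lmodType R) (T : finType) (phi : T -> Y -> R) :
  (forall j, convex_fun (phi j)) -> convex_fun (fun y => \sum_j phi j y).
Proof.
move=> h x y t _ _ t01; rewrite !mulr_sumr -big_split /=; apply: ler_sum => j _.
exact: h.
Qed.

Lemma convex_fst (Y1 Y2 : lmodType R) (phi : Y1 -> R) :
  convex_fun phi -> convex_fun (fun y : Y1 * Y2 => phi y.1).
Proof. by move=> h [x1 x2] [y1 y2] t _ _ t01; exact: h. Qed.

Lemma convex_snd (Y1 Y2 : lmodType R) (phi : Y2 -> R) :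
  convex_fun phi -> convex_fun (fun y : Y1 * Y2 => phi y.2).
Proof. by move=> h [x1 x2] [y1 y2] t _ _ t01; exact: h. Qed.

Lemma convex_coord m k i j (h : R -> R) :
  (forall a b t : R, 0 <= t <= 1 -> h (t * a + (1 - t) * b) <= t * h a + (1 - t) * h b) ->
  convex_fun (fun M : 'M[R]_(m, k) => h (M i j)).
Proof. by move=> hh x y t _ _ t01; rewrite !mxE; exact: hh. Qed.

Lemma convex_hinge n J (y : 'I_n -> 'I_J) : convex_fun (hinge y : 'M[R]_(n, J) -> R).
Proof.
apply: convex_scale; first by rewrite invr_ge0 ler0n.
apply: convex_sum => i; apply: convex_sum => j; apply: convex_scale.
  by rewrite /cost; case: ifP.
apply: convex_coord => a b t t01.
rewrite /pospart; have := ler_wpM2l (_ : 0 <= t) (_ : a <= Num.max a 0).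
have m1 c : c <= Num.max c (0 : R) by rewrite le_max lexx.
have m2 c : 0 <= Num.max c (0 : R) by rewrite le_max lexx orbT.
have m1a := m1 a; have m1b := m1 b; have m2a := m2 a; have m2b := m2 b.
rewrite ge_max; move=> _; apply/andP; split; nra.
Qed.

Lemma convex_l1norm m k : convex_fun (@l1norm R m k).
Proof.
apply: convex_sum => i; apply: convex_sum => j.
apply: (@convex_coord m k i j Num.norm) => a b t /andP[t0 t1].
apply: le_trans (ler_normD _ _) _; rewrite !normrM (ger0_norm t0) (ger0_norm (_ : 0 <= 1 - t)) //.
by rewrite subr_ge0.
Qed.

Lemma convex_frob2 m k : convex_fun (@frob2 R m k).
Proof.
apply: convex_sum => i; apply: convex_sum => j.
apply: (@convex_coord m k i j (fun a => a ^+ 2)) => a b t /andP[t0 t1].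
have := sqr_ge0 (a - b); have : 0 <= t * (1 - t) by rewrite mulr_ge0 // subr_ge0.
nra.
Qed.

Lemma ip_sqrt_convex (Z : lmodType R) (ip : Z -> Z -> R) : inner_product ip ->
  convex_fun (fun z => Num.sqrt (ip z z)).
Proof.
move=> ipP a b t _ _ /andP[t0 t1].
have s0 : 0 <= 1 - t by rewrite subr_ge0.
set A := Num.sqrt (ip a a); set B := Num.sqrt (ip b b).
have A0 : 0 <= A by rewrite sqrtr_ge0.
have B0 : 0 <= B by rewrite sqrtr_ge0.
have rhs0 : 0 <= t * A + (1 - t) * B by rewrite addr_ge0 ?mulr_ge0.
rewrite -(ger0_norm rhs0) -sqrtr_sqr ler_wsqrtr //.
have qa : ip a a = A ^+ 2 by rewrite sqr_sqrtr // (ip_ge0 ipP).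
have qb : ip b b = B ^+ 2 by rewrite sqr_sqrtr // (ip_ge0 ipP).
have := le_trans (ler_norm _) (ip_norm_le ipP a b); rewrite -/A -/B => hab.
rewrite !(ipE ipP) (ipC ipP b a) qa qb.
have := ler_wpM2l (mulr_ge0 t0 s0) hab; lra.
Qed.

Lemma convex_rownorm q k : convex_fun (@rownorm R q k).
Proof.
case: q => /=; last first.
  move=> a b t _ _ /andP[t0 t1].
  have s0 : 0 <= 1 - t by rewrite subr_ge0.
  have M0 (v : 'rV[R]_k) : 0 <= \big[Num.max/0]_l `|v 0 l| by apply: bigmax_ge_id.
  rewrite /rownorm; apply: bigmax_le; first by rewrite addr_ge0 ?mulr_ge0 ?M0.
  move=> l _; rewrite !mxE; apply: le_trans (ler_normD _ _) _.
  rewrite !normrM (ger0_norm t0) (ger0_norm s0).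
  rewrite lerD ?ler_wpM2l //; first exact: (le_bigmax 0 (fun l => `|a 0 l|)).
  exact: (le_bigmax 0 (fun l => `|b 0 l|)).
have -> : (@rownorm R q_two k : 'rV[R]_k -> R) = (fun v => Num.sqrt (inner v v)).
  apply/funext => v; rewrite /rownorm; congr Num.sqrt; rewrite innerE big_ord1.
  by apply: eq_bigr => l _; rewrite expr2.
exact: ip_sqrt_convex (@inner_mxP R 1 k).
Qed.

Lemma convex_groupnorm q m k : convex_fun (@groupnorm R q m k).
Proof.
apply: convex_sum => i a b t _ _ t01.
rewrite linearD !linearZ /=; exact: convex_rownorm.
Qed.

End Convexity.

(** * Attainment *)

Section Attainment.
Variables (R : realType) (n p J : nat) (X : 'M[R]_(p, n)) (y : 'I_n -> 'I_J).

Definition margin (W : 'M[R]_(p, J)) (b : 'cV[R]_J) : 'M[R]_(n, J) :=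
  X^T *m W + (const_mx 1 : 'cV[R]_n) *m b^T + const_mx 1.

Lemma marginE W b i j : margin W b i j = \sum_k X k i * W k j + b j 0 + 1.
Proof.
rewrite !mxE big_ord1 !mxE mul1r; congr (_ + _ + _).
by apply: eq_bigr => k _; rewrite mxE.
Qed.

Lemma inDE (W : 'M[R]_(p, J)) (b : 'cV[R]_J) :
  inD W b <-> (forall i, \sum_j W i j = 0) /\ \sum_j b j 0 = 0.
Proof.
split=> [[hW hb]|[hW hb]]; split.
- move=> i; have := congr1 (fun M : 'M[R]_(p, 1) => M i 0) hW; rewrite /= !mxE => h.
  by rewrite -[RHS]h; apply: eq_bigr => j _; rewrite mxE mulr1.
- have := congr1 (fun M : 'M[R]_1 => M 0 0) hb; rewrite /= !mxE => h.
  by rewrite -[RHS]h; apply: eq_bigr => j _; rewrite mxE mul1r.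
- apply/matrixP => i j; rewrite !mxE -[RHS](hW i).
  by apply: eq_bigr => k _; rewrite mxE mulr1.
- apply/matrixP => i j; rewrite !mxE -[RHS]hb (ord1 j).
  by apply: eq_bigr => k _; rewrite mxE mul1r.
Qed.

Lemma cost_ge0 i j : 0 <= cost R y i j.
Proof. by rewrite /cost; case: ifP. Qed.

Lemma pospart_ge0 (a : R) : 0 <= pospart a.
Proof. by rewrite /pospart le_max lexx orbT. Qed.

Lemma hinge_ge0 (A : 'M[R]_(n, J)) : 0 <= hinge y A.
Proof.
rewrite mulr_ge0 ?invr_ge0 ?ler0n //; apply: sumr_ge0 => i _; apply: sumr_ge0 => j _.
by rewrite mulr_ge0 ?cost_ge0 ?pospart_ge0.
Qed.

(** The unknowns are [W] and the positive and negative parts of the margin; the functionals are the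
    margin equation, the row sums and the weighted positive parts. Removing the conformal kernel
    part changes none of their values and keeps the parts nonnegative, so the loss cannot grow. The
    rest is bounded by those values, in which [W] enters only through the hinge terms. *)
Lemma hinge_bounded_argument : exists2 kap : R, 0 <= kap & forall W b, inD W b ->
  exists W', [/\ inD W' b, hinge y (margin W' b) <= hinge y (margin W b) &
   forall i j, `|W' i j| <= kap * (\sum_(i < n) \sum_j `|b j 0 + 1|
      + \sum_i \sum_j cost R y i j * pospart (margin W b i j))].
Proof.
pose I := (('I_p * 'I_J) + ('I_n * 'I_J) + ('I_n * 'I_J))%type.
pose O := (('I_n * 'I_J) + 'I_p + ('I_n * 'I_J))%type.
pose ell (o : O) (t : I -> R) : R := match o with
  | inl (inl (i, j)) => \sum_k X k i * t (inl (inl (k, j)))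
        - t (inl (inr (i, j))) + t (inr (i, j))
  | inl (inr i) => \sum_j t (inl (inl (i, j)))
  | inr (i, j) => cost R y i j * t (inl (inr (i, j))) end.
have ellP : linfam ell.
  move=> [[[i j]|i]|[i j]] a s t /=; last by ring.
    rewrite -[LHS](_ : a * (\sum_k X k i * s (inl (inl (k, j)))) +
       \sum_k X k i * t (inl (inl (k, j))) - (a * s (inl (inr (i, j))) + t (inl (inr (i, j))))
       + (a * s (inr (i, j)) + t (inr (i, j))) = _); first by ring.
    congr (_ - _ + _); rewrite mulr_sumr -big_split /=; apply: eq_bigr => k _; ring.
  by rewrite big_split mulr_sumr.
have [kap kap0 kapP] := conformal_decomp ellP.
exists kap => // W b /inDE[hW hb].
pose t (i : I) : R := match i with
  | inl (inl (k, j)) => W k j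
  | inl (inr (i, j)) => pospart (margin W b i j)
  | inr (i, j) => pospart (- margin W b i j) end.
have [th [th01 ker bnd]] := kapP t.
pose t' i := t i - th i * t i.
have ellt' o : ell o t' = ell o t.
  have := ellP o (-1) (fun i => th i * t i) t; rewrite ker mulr0 add0r => <-.
  by congr ell; apply/funext => i; rewrite /t'; ring.
pose W' : 'M[R]_(p, J) := \matrix_(i, j) t' (inl (inl (i, j))).
have t'pos i : 0 <= t i -> 0 <= t' i.
  move=> ti; rewrite /t'; have := th01 i; nra.
have hM i j : margin W' b i j = t' (inl (inr (i, j))) - t' (inr (i, j)).
  have := ellt' (inl (inl (i, j))) => /=.
  have : margin W b i j = pospart (margin W b i j) - pospart (- margin W b i j).
    by rewrite /pospart !maxEle; case: ifP; case: ifP; lra.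
  rewrite !marginE.
  under [in X in _ -> _ -> X = _]eq_bigr do rewrite mxE.
  lra.
have hP i j : cost R y i j * t' (inl (inr (i, j))) = cost R y i j * pospart (margin W b i j).
  exact: (ellt' (inr (i, j))).
exists W'; split.
- apply/inDE; split => // i; rewrite -[RHS](hW i) -[RHS](ellt' (inl (inr i))) /=.
  by apply: eq_bigr => j _; rewrite mxE.
- rewrite ler_wpM2l ?invr_ge0 ?ler0n //; apply: ler_sum => i _; apply: ler_sum => j _.
  rewrite -hP ler_wpM2l ?cost_ge0 // hM /pospart ge_max.
  rewrite (t'pos (inl (inr _))) ?pospart_ge0 // andbT.
  by rewrite lerBlDr lerDl (t'pos (inr _)) // pospart_ge0.
- move=> i j; rewrite mxE; apply: le_trans (bnd _) _; rewrite ler_wpM2l //.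
  rewrite /linsize big_sumType /= big_sumType /= lerD //.
    rewrite [X in _ + X]big1 ?addr0; last by move=> k _; rewrite hW normr0.
    rewrite [leRHS]pair_big /= le_eqVlt; apply/orP; left; apply/eqP.
    apply: eq_bigr => -[k l] _ /=; rewrite -normrN; congr (`|_|).
    have : margin W b k l = pospart (margin W b k l) - pospart (- margin W b k l).
      by rewrite /pospart !maxEle; case: ifP; case: ifP; lra.
    rewrite {1}marginE; lra.
  rewrite [leRHS]pair_big /= le_eqVlt; apply/orP; left; apply/eqP.
  apply: eq_bigr => -[k l] _ /=; rewrite ger0_norm // mulr_ge0 ?cost_ge0 ?pospart_ge0 //.
Qed.

Variables (lam1 lam2 lam3 : R) (psi : 'M[R]_(p, J) -> R).
Hypothesis n0 : (0 < n)%N.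
Hypotheses (l1 : 0 <= lam1) (l2 : 0 <= lam2) (l3 : 0 < lam3).

Definition svm_objective W b : R :=
  hinge y (margin W b) + lam1 * l1norm W + lam2 * psi W + lam3 / 2 * frob2 b.

Let I := (('I_p * 'I_J) + 'I_J)%type.
Definition Wof (t : I -> R) : 'M[R]_(p, J) := \matrix_(i, j) t (inl (i, j)).
Definition bof (t : I -> R) : 'cV[R]_J := \col_j t (inr j).

Hypothesis psi_ge0 : forall W, 0 <= psi W.
(** One form for both regularizers: for half the squared Frobenius norm it follows from
    [2 * |w| <= 1 + w ^ 2], and a group norm dominates each entry directly. *)
Hypothesis psi_coercive : forall (W : 'M[R]_(p, J)) i j, `|W i j| <= 1 + 2 * psi W.
Hypothesis psi_cont : contI (fun t => psi (Wof t)).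

Lemma entry_le_l1norm m k (W : 'M[R]_(m, k)) i j : `|W i j| <= l1norm W.
Proof.
rewrite /l1norm (bigD1 i) //= (bigD1 j) //= -addrA lerDl addr_ge0 ?sumr_ge0 //.
by move=> i' _; rewrite sumr_ge0.
Qed.

Lemma entry_le_frob2 m k (W : 'M[R]_(m, k)) i j : W i j ^+ 2 <= frob2 W.
Proof.
have s0 (i' : 'I_m) (P : pred 'I_k) : 0 <= \sum_(j' | P j') W i' j' ^+ 2.
  by apply: sumr_ge0 => ? _; exact: sqr_ge0.
rewrite /frob2 (bigD1 i) //= (bigD1 j) //= -addrA lerDl addr_ge0 //.
by apply: sumr_ge0 => i' _; exact: s0.
Qed.

Lemma l1norm_ge0 m k (W : 'M[R]_(m, k)) : 0 <= l1norm W.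
Proof. by rewrite sumr_ge0 // => i _; rewrite sumr_ge0. Qed.

Lemma svm_objective_cont : contI (fun t => svm_objective (Wof t) (bof t)).
Proof.
have cW i j : contI (fun t : I -> R => Wof t i j).
  have -> : (fun t : I -> R => Wof t i j) = (fun t => t (inl (i, j))).
    by apply/funext => t; rewrite mxE.
  exact: contI_coord.
have cb j : contI (fun t : I -> R => bof t j 0).
  have -> : (fun t : I -> R => bof t j 0) = (fun t => t (inr j)).
    by apply/funext => t; rewrite mxE.
  exact: contI_coord.
rewrite /svm_objective; apply: contI_add; [apply: contI_add; [apply: contI_add|]|].
- apply: contI_mul; first exact: contI_cst.
  apply: contI_sum => i; apply: contI_sum => j; apply: contI_mul; first exact: contI_cst.
  apply: contI_max; last exact: contI_cst.
  have -> : (fun t : I -> R => margin (Wof t) (bof t) i j)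
     = (fun t => \sum_k X k i * Wof t k j + bof t j 0 + 1).
    by apply/funext => t; rewrite marginE.
  apply: contI_add; last exact: contI_cst.
  apply: contI_add => //; apply: contI_sum => k; apply: contI_mul => //; exact: contI_cst.
- apply: contI_mul; first exact: contI_cst.
  by apply: contI_sum => i; apply: contI_sum => j; exact: contI_norm.
- apply: contI_mul => //; exact: contI_cst.
- apply: contI_mul; first exact: contI_cst.
  apply: contI_sum => i; apply: contI_sum => j; rewrite (ord1 j).
  have -> : (fun t : I -> R => bof t i 0 ^+ 2) = (fun t => bof t i 0 * bof t i 0).
    by apply/funext => t; rewrite expr2.
  exact: contI_mul.
Qed.

(** Without a penalty on [W] sublevel sets may be unbounded, so only a representative [W'] with no
    larger objective is confined to the box. *)
Lemma svm_sublevel_bounded (M : R) : exists2 B, 0 <= B & forall W b, inD W b ->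
  svm_objective W b <= M ->
  exists W', [/\ inD W' b, svm_objective W' b <= svm_objective W b,
    forall i j, `|W' i j| <= B & forall j, `|b j 0| <= B].
Proof.
have parts W b : svm_objective W b <= M -> [/\ hinge y (margin W b) <= M,
    lam1 * l1norm W <= M, lam2 * psi W <= M & lam3 / 2 * frob2 b <= M].
  have h1 := hinge_ge0 (margin W b); have h2 := mulr_ge0 l1 (l1norm_ge0 W).
  have h3 := mulr_ge0 l2 (psi_ge0 W).
  have h4 : 0 <= lam3 / 2 * frob2 b by rewrite mulr_ge0 ?frob2_ge0 // ltW // divr_gt0.
  rewrite /svm_objective => h; split; lra.
(* From [b_j ^ 2 <= 2 * |M| / lam3] and [|b_j| <= 1 + b_j ^ 2]. *)
pose Bb := 1 + `|M| * 2 / lam3.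
have bb W b j : svm_objective W b <= M -> `|b j 0| <= Bb.
  move=> /parts[_ _ _ h].
  have : frob2 b <= `|M| * 2 / lam3.
    by rewrite ler_pdivlMr //; have := ler_norm M; lra.
  have := entry_le_frob2 b j 0; rewrite -(real_normK (num_real (b j 0))) /Bb.
  have := sqr_ge0 (`|b j 0| - 1); nra.
have Bb0 : 0 <= Bb by rewrite addr_ge0 ?divr_ge0 ?mulr_ge0 // ltW.
have M0 := normr_ge0 M.
have [l10|l1n] := ltP 0 lam1.
  have B0 : 0 <= `|M| / lam1 by rewrite divr_ge0.
  exists (Bb + `|M| / lam1); first lra.
  move=> W b Db h; exists W; split => // [i j|j]; last by have := bb _ _ j h; lra.
  have [_ h1 _ _] := parts _ _ h.
  have : `|W i j| <= `|M| / lam1.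
    rewrite ler_pdivlMr // mulrC; apply: le_trans (ler_norm M); apply: le_trans h1.
    by rewrite ler_pM2l // entry_le_l1norm.
  lra.
have [l20|l2n] := ltP 0 lam2.
  have B0 : 0 <= `|M| / lam2 by rewrite divr_ge0.
  exists (Bb + (1 + 2 * (`|M| / lam2))); first lra.
  move=> W b Db h; exists W; split => // [i j|j]; last by have := bb _ _ j h; lra.
  have [_ _ h2 _] := parts _ _ h.
  have : psi W <= `|M| / lam2.
    by rewrite ler_pdivlMr // mulrC; apply: le_trans (ler_norm M).
  have := psi_coercive W i j; lra.
have l1e : lam1 = 0 by apply/eqP; rewrite eq_le l1 l1n.
have l2e : lam2 = 0 by apply/eqP; rewrite eq_le l2 l2n.
have [kap kap0 kapP] := hinge_bounded_argument.
(* The factor [n] undoes the averaging in [hinge]. *)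
pose Bw := kap * (\sum_(i < n) \sum_(j < J) (Bb + 1) + n%:R * `|M|).
have Bw0 : 0 <= Bw.
  rewrite mulr_ge0 // addr_ge0 ?mulr_ge0 ?ler0n //.
  by apply: sumr_ge0 => i _; apply: sumr_ge0 => j _; lra.
exists (Bb + Bw); first lra.
move=> W b Db h; have [W' [DW' hW' bW']] := kapP W b Db.
exists W'; split => // [|i j|j]; last by have := bb _ _ j h; lra.
  by rewrite /svm_objective l1e l2e; lra.
suff : `|W' i j| <= Bw by lra.
apply: le_trans (bW' i j) _; rewrite ler_wpM2l // lerD //.
  apply: ler_sum => k _; apply: ler_sum => l _.
  by apply: le_trans (ler_normD _ _) _; rewrite normr1 lerD2r; exact: bb h.
have [h1 _ _ _] := parts _ _ h.
have : n%:R * hinge y (margin W b) <= n%:R * `|M|.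
  by rewrite ler_wpM2l ?ler0n //; apply: le_trans (ler_norm _).
by rewrite /hinge mulrA mulfV ?mul1r // pnatr_eq0 -lt0n.
Qed.

Lemma svm_attained : exists W b, inD W b /\
  forall W' b', inD W' b' -> svm_objective W b <= svm_objective W' b'.
Proof.
have [B B0 BP] := svm_sublevel_bounded (svm_objective 0 0).
pose ell (o : 'I_p + unit) (t : I -> R) := match o with
  | inl i => \sum_j t (inl (i, j)) | inr _ => \sum_j t (inr j) end.
(* Each linear equation of [inD] is encoded as two opposite inequalities, the format of
   [box_EVT]. *)
pose g (o : bool * ('I_p + unit)) t := if o.1 then ell o.2 t else - ell o.2 t.
have gP t : (forall o, 0 <= g o t) <-> inD (Wof t) (bof t).
  have E : inD (Wof t) (bof t) <-> forall o, ell o t = 0.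
    rewrite inDE; split=> [[hW hb] [i|[]] /=|h].
    - by rewrite -[RHS](hW i); apply: eq_bigr => j _; rewrite mxE.
    - by rewrite -[RHS]hb; apply: eq_bigr => j _; rewrite mxE.
    - split=> [i|]; first by rewrite -[RHS](h (inl i)); apply: eq_bigr => j _; rewrite mxE.
      by rewrite -[RHS](h (inr tt)); apply: eq_bigr => j _; rewrite mxE.
  rewrite E; split=> [h o|h [[] o]]; [|by rewrite /g /= h|by rewrite /g /= h oppr0].
  by have := h (true, o); have := h (false, o); rewrite /g /=; lra.
have D0 : inD (0 : 'M[R]_(p, J)) 0 by split; rewrite ?mul0mx ?mulmx0.
have W0 : Wof (fun=> 0) = 0 by apply/matrixP => i j; rewrite !mxE.
have b0 : bof (fun=> 0) = 0 by apply/matrixP => i j; rewrite !mxE.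
have [||t [gt Bt tmin]] := box_EVT (g := g) (B := B) svm_objective_cont.
- have c o : contI (ell o).
    by case: o => [i|[]]; apply: contI_sum => j; exact: contI_coord.
  by move=> [[] o]; rewrite /g /=; [exact: c|apply: contI_opp; exact: c].
- by exists (fun=> 0); split => [|i]; [apply/gP; rewrite W0 b0|rewrite normr0].
exists (Wof t), (bof t); split; first exact/gP.
move=> W b Db; have [le|gt0] := leP (svm_objective W b) (svm_objective 0 0).
  have [W' [DW' hle BW Bb]] := BP W b Db le; apply: le_trans hle.
  pose s (i : I) := match i with inl (i, j) => W' i j | inr j => b j 0 end.
  have Ws : Wof s = W' by apply/matrixP => i j; rewrite mxE.
  have bs : bof s = b by apply/matrixP => i j; rewrite mxE (ord1 j).
  have := tmin s; rewrite Ws bs; apply; first by apply/gP; rewrite Ws bs.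
  by case=> [[i j]|j] /=; [exact: BW|exact: Bb].
apply: le_trans (ltW gt0); have := tmin (fun=> 0); rewrite W0 b0; apply.
  by apply/gP; rewrite W0 b0.
by move=> i; rewrite normr0.
Qed.

End Attainment.

(** * Problems (P1) and (P2) *)

Section Instances.
Variables (R : realType) (n p J : nat) (X : 'M[R]_(p, n)) (y : 'I_n -> 'I_J).
Variables (lam1 lam2 lam3 : R).
Hypothesis n0 : (0 < n)%N.
Hypotheses (l1 : 0 <= lam1) (l2 : 0 <= lam2) (l3 : 0 < lam3).

Let Xsp : lmodType R := ('M[R]_(p, J) * 'cV[R]_J)%type.
Let Z1 : lmodType R := ('M[R]_(n, J) * 'M[R]_(p, J))%type.
Let Z2 : lmodType R := (('M[R]_(n, J) * 'M[R]_(p, J)) * 'M[R]_(p, J))%type.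

(* The first block is x = (W, b), the second is z = (A, U) for (P1) and z = ((A, U), V)
   for (P2); the scaled multipliers are Pi / alpha, Lam / mu and Gam / nu. *)
Definition inDx (x : 'M[R]_(p, J) * 'cV[R]_J) := inD x.1 x.2.
Definition K1 (x : 'M[R]_(p, J) * 'cV[R]_J) := (margin X x.1 x.2, x.1).
Definition K2 (x : 'M[R]_(p, J) * 'cV[R]_J) := (K1 x, x.1).
Definition f1 (x : 'M[R]_(p, J) * 'cV[R]_J) : R :=
  lam2 / 2 * frob2 x.1 + lam3 / 2 * frob2 x.2.
Definition g1 (z : 'M[R]_(n, J) * 'M[R]_(p, J)) : R := hinge y z.1 + lam1 * l1norm z.2.
Definition f2 (x : 'M[R]_(p, J) * 'cV[R]_J) : R := lam3 / 2 * frob2 x.2.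
Definition g2 (q : qexp) (z : ('M[R]_(n, J) * 'M[R]_(p, J)) * 'M[R]_(p, J)) : R :=
  g1 z.1 + lam2 * groupnorm q z.2.
Definition ip1 (alpha mu : R) := pair_ip (@wip R n J alpha) (@wip R p J mu).
Definition ip2 (alpha mu nu : R) := pair_ip (ip1 alpha mu) (@wip R p J nu).

Lemma inDx_cvx : cvx_set (inDx : Xsp -> Prop).
Proof.
move=> [W1 b1] [W2 b2] t [/= h1 h2] [/= h3 h4] _; split => /=.
  by rewrite mulmxDl -!scalemxAl h1 h3 !scaler0 addr0.
by rewrite mulmxDr -!scalemxAr h2 h4 !scaler0 addr0.
Qed.

Lemma margin_aff (W1 W2 : 'M[R]_(p, J)) b1 b2 (t : R) :
  margin X (t *: W1 + (1 - t) *: W2) (t *: b1 + (1 - t) *: b2)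
  = t *: margin X W1 b1 + (1 - t) *: margin X W2 b2.
Proof.
apply/matrixP => i j; rewrite marginE !mxE !big_ord1 !mxE.
have -> : \sum_k X k i * (t *: W1 + (1 - t) *: W2) k j
    = t * (\sum_k X^T i k * W1 k j) + (1 - t) * (\sum_k X^T i k * W2 k j).
  rewrite !mulr_sumr -big_split /=; apply: eq_bigr => k _; rewrite !mxE; ring.
ring.
Qed.

Lemma K1_aff (x1 x2 : Xsp) (t : R) :
  K1 (t *: x1 + (1 - t) *: x2 : Xsp) = t *: (K1 x1 : Z1) + (1 - t) *: (K1 x2 : Z1).
Proof. by case: x1 x2 => [W1 b1] [W2 b2]; congr pair; exact: margin_aff. Qed.

Lemma K2_aff (x1 x2 : Xsp) (t : R) :
  K2 (t *: x1 + (1 - t) *: x2 : Xsp) = t *: (K2 x1 : Z2) + (1 - t) *: (K2 x2 : Z2).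
Proof. by case: x1 x2 => [W1 b1] [W2 b2]; congr pair; exact: K1_aff. Qed.

Let half_ge0 (a : R) : 0 <= a -> 0 <= a / 2.
Proof. by move=> a0; rewrite divr_ge0. Qed.

Lemma f1_cvx : cvx_on inDx (f1 : Xsp -> R).
Proof.
apply/cvx_restr/convex_add; apply: convex_scale; rewrite ?half_ge0 ?(ltW l3) //.
  exact: (@convex_fst R 'M[R]_(p, J) 'cV[R]_J (@frob2 R p J) (@convex_frob2 R p J)).
exact: (@convex_snd R 'M[R]_(p, J) 'cV[R]_J (@frob2 R J 1) (@convex_frob2 R J 1)).
Qed.

Lemma f2_cvx : cvx_on inDx (f2 : Xsp -> R).
Proof.
apply/cvx_restr; apply: convex_scale; rewrite ?half_ge0 ?(ltW l3) //.
exact: (@convex_snd R 'M[R]_(p, J) 'cV[R]_J (@frob2 R J 1) (@convex_frob2 R J 1)).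
Qed.

Lemma g1_cvx : convex_fun (g1 : Z1 -> R).
Proof.
apply: convex_add; first exact: (@convex_fst R 'M[R]_(n, J) 'M[R]_(p, J) _ (convex_hinge y)).
apply: convex_scale => //.
exact: (@convex_snd R 'M[R]_(n, J) 'M[R]_(p, J) _ (@convex_l1norm R p J)).
Qed.

Lemma g2_cvx q : convex_fun (g2 q : Z2 -> R).
Proof.
apply: convex_add; first exact: (@convex_fst R Z1 'M[R]_(p, J) _ g1_cvx).
apply: convex_scale => //.
exact: (@convex_snd R Z1 'M[R]_(p, J) _ (@convex_groupnorm R q p J)).
Qed.

Lemma ip1P alpha mu : 0 < alpha -> 0 < mu -> inner_product (ip1 alpha mu).
Proof. by move=> a0 m0; apply: pair_ipP; exact: wipP. Qed.

Lemma ip2P alpha mu nu : 0 < alpha -> 0 < mu -> 0 < nu -> inner_product (ip2 alpha mu nu).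
Proof. by move=> a0 m0 v0; apply: pair_ipP; [exact: ip1P|exact: wipP]. Qed.

Lemma residE W b (A : 'M[R]_(n, J)) : resid X W b A = margin X W b - A.
Proof. by rewrite /resid /margin addrAC. Qed.

Lemma wip_scale m k (a : R) (P Q : 'M[R]_(m, k)) : 0 < a -> wip a (a^-1 *: P) Q = inner P Q.
Proof.
move=> a0; rewrite /wip (ipZl (@inner_mxP R m k)) mulrA mulfV ?mul1r //; by rewrite gt_eqF.
Qed.

Lemma L1E alpha mu W b (A : 'M[R]_(n, J)) (U : 'M[R]_(p, J)) Pi Lam : 0 < alpha -> 0 < mu ->
  L1 X y lam1 lam2 lam3 alpha mu W b A U Pi Lam =
  aug (ip1 alpha mu) (f1 : Xsp -> R) (g1 : Z1 -> R) (K1 : Xsp -> Z1) (W, b) (A, U)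
    (alpha^-1 *: Pi, mu^-1 *: Lam).
Proof.
move=> a0 m0; rewrite /aug /ip1 /pair_ip /= !wip_scale // /wip.
rewrite /L1 /F1 /f1 /g1 /= residE -!frob2E; lra.
Qed.

Lemma L2E q alpha mu nu W b (A : 'M[R]_(n, J)) (U V : 'M[R]_(p, J)) Pi Lam Gam :
  0 < alpha -> 0 < mu -> 0 < nu ->
  L2 q X y lam1 lam2 lam3 alpha mu nu W b A U V Pi Lam Gam =
  aug (ip2 alpha mu nu) (f2 : Xsp -> R) (g2 q : Z2 -> R) (K2 : Xsp -> Z2)
   (W, b) ((A, U), V) ((alpha^-1 *: Pi, mu^-1 *: Lam), nu^-1 *: Gam).
Proof.
move=> a0 m0 v0; rewrite /aug /ip2 /ip1 /pair_ip /= !wip_scale // /wip.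
rewrite /L2 /F2 /f2 /g2 /g1 /= residE -!frob2E; lra.
Qed.

Lemma admm1_seq alpha mu Wk bk Ak Uk Pik Lamk : 0 < alpha -> 0 < mu ->
  admm1 X y lam1 lam2 lam3 alpha mu Wk bk Ak Uk Pik Lamk ->
  admm_seq (ip1 alpha mu) inDx (f1 : Xsp -> R) (g1 : Z1 -> R) (K1 : Xsp -> Z1)
    (fun k => (Wk k, bk k)) (fun k => (Ak k, Uk k))
    (fun k => (alpha^-1 *: Pik k, mu^-1 *: Lamk k)).
Proof.
move=> a0 m0 h k; have [[Dk hx] hz hP hL] := h k.
have sK (c : R) m l (M N : 'M[R]_(m, l)) : 0 < c -> c^-1 *: (M + c *: N) = c^-1 *: M + N.
  by move=> c0; rewrite scalerDr scalerA mulVf ?scale1r // gt_eqF.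
split => //.
- by move=> [W b] Dy; rewrite -!L1E //; exact: hx.
- by move=> [A U]; rewrite -!L1E //; exact: hz.
- by rewrite hP hL !sK // residE.
Qed.

Lemma admm2_seq q alpha mu nu Wk bk Ak Uk Vk Pik Lamk Gamk : 0 < alpha -> 0 < mu -> 0 < nu ->
  admm2 q X y lam1 lam2 lam3 alpha mu nu Wk bk Ak Uk Vk Pik Lamk Gamk ->
  admm_seq (ip2 alpha mu nu) inDx (f2 : Xsp -> R) (g2 q : Z2 -> R) (K2 : Xsp -> Z2)
    (fun k => (Wk k, bk k)) (fun k => ((Ak k, Uk k), Vk k))
    (fun k => ((alpha^-1 *: Pik k, mu^-1 *: Lamk k), nu^-1 *: Gamk k)).
Proof.
move=> a0 m0 v0 h k; have [[Dk hx] hz hP hL hG] := h k.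
have sK (c : R) m l (M N : 'M[R]_(m, l)) : 0 < c -> c^-1 *: (M + c *: N) = c^-1 *: M + N.
  by move=> c0; rewrite scalerDr scalerA mulVf ?scale1r // gt_eqF.
split => //.
- by move=> [W b] Dy; rewrite -!L2E //; exact: hx.
- by move=> [[A U] V]; rewrite -!L2E //; exact: hz.
- by rewrite hP hL hG !sK // residE.
Qed.

Let contW i j : contI (fun t : ('I_p * 'I_J) + 'I_J -> R => Wof t i j).
Proof.
have -> : (fun t : ('I_p * 'I_J) + 'I_J -> R => Wof t i j) = (fun t => t (inl (i, j))).
  by apply/funext => t; rewrite mxE.
exact: contI_coord.
Qed.

Let contsq (I : finType) (h : (I -> R) -> R) : contI h -> contI (fun t => h t ^+ 2).
Proof.
move=> c; have -> : (fun t => h t ^+ 2) = (fun t => h t * h t).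
  by apply/funext => t; rewrite expr2.
exact: contI_mul.
Qed.

Lemma frob2_cont : contI (fun t => frob2 (Wof t : 'M[R]_(p, J)) / 2).
Proof.
apply: contI_mul; last exact: contI_cst.
by apply: contI_sum => i; apply: contI_sum => j; exact: contsq.
Qed.

Lemma groupnorm_cont q : contI (fun t => groupnorm q (Wof t : 'M[R]_(p, J))).
Proof.
apply: contI_sum => i.
have c j : contI (fun t : ('I_p * 'I_J) + 'I_J -> R => row i (Wof t) 0 j).
  have -> : (fun t : ('I_p * 'I_J) + 'I_J -> R => row i (Wof t) 0 j) = (fun t => Wof t i j).
    by apply/funext => t; rewrite mxE.
  exact: contW.
case: q; rewrite /rownorm.
  by apply: contI_sqrt; apply: contI_sum => j; exact: contsq.
by apply: contI_bigmax => j; exact: contI_norm.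
Qed.

Lemma rownorm_ge0 q k (v : 'rV[R]_k) : 0 <= rownorm q v.
Proof. by case: q; rewrite /rownorm ?sqrtr_ge0 //; exact: bigmax_ge_id. Qed.

Lemma entry_le_rownorm q k (v : 'rV[R]_k) j : `|v 0 j| <= rownorm q v.
Proof.
case: q; rewrite /rownorm; last exact: (le_bigmax 0 (fun l => `|v 0 l|)).
rewrite -sqrtr_sqr ler_wsqrtr // (bigD1 j) //= lerDl sumr_ge0 // => l _; exact: sqr_ge0.
Qed.

Lemma groupnorm_ge0 q m k (V : 'M[R]_(m, k)) : 0 <= groupnorm q V.
Proof. by apply: sumr_ge0 => i _; exact: rownorm_ge0. Qed.

Lemma entry_le_groupnorm q m k (V : 'M[R]_(m, k)) i j : `|V i j| <= groupnorm q V.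
Proof.
have -> : V i j = row i V 0 j by rewrite mxE.
apply: le_trans (entry_le_rownorm q _ _) _.
by rewrite /groupnorm (bigD1 i) //= lerDl sumr_ge0 // => k' _; exact: rownorm_ge0.
Qed.

Lemma P1_saddle alpha mu : 0 < alpha -> 0 < mu ->
  exists s, saddle (ip1 alpha mu) inDx (f1 : Xsp -> R) (g1 : Z1 -> R) (K1 : Xsp -> Z1) s.
Proof.
move=> a0 m0.
have [|W i j||W [b [Db hmin]]] := @svm_attained R n p J X y lam1 lam2 lam3
  (fun W => frob2 W / 2) n0 l1 l2 l3.
- by move=> W; rewrite half_ge0 // frob2_ge0.
- have := entry_le_frob2 W i j; rewrite -(real_normK (num_real (W i j))).
  have := sqr_ge0 (`|W i j| - 1); nra.
- exact: frob2_cont.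
have [| | | | | | |x Dx|us usP] := @saddle_exists R Xsp Z1 (ip1 alpha mu) inDx f1 g1 K1 (W, b).
- by apply: pair_coordinatized; exact: wip_coordinatized.
- exact: ip1P.
- exact: inDx_cvx.
- exact: f1_cvx.
- exact: g1_cvx.
- exact: K1_aff.
- exact: Db.
- have := hmin _ _ Dx; rewrite /svm_objective /f1 /g1 /=; lra.
by exists ((W, b), us).
Qed.

Lemma P2_saddle q alpha mu nu : 0 < alpha -> 0 < mu -> 0 < nu ->
  exists s, saddle (ip2 alpha mu nu) inDx (f2 : Xsp -> R) (g2 q : Z2 -> R) (K2 : Xsp -> Z2) s.
Proof.
move=> a0 m0 v0.
have [|W i j||W [b [Db hmin]]] := @svm_attained R n p J X y lam1 lam2 lam3
  (@groupnorm R q p J) n0 l1 l2 l3.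
- exact: groupnorm_ge0.
- by have := entry_le_groupnorm q W i j; have := groupnorm_ge0 q W; lra.
- exact: groupnorm_cont.
have [| | | | | | |x Dx|us usP] :=
    @saddle_exists R Xsp Z2 (ip2 alpha mu nu) inDx f2 (g2 q) K2 (W, b).
- apply: pair_coordinatized; last exact: wip_coordinatized.
  by apply: pair_coordinatized; exact: wip_coordinatized.
- exact: ip2P.
- exact: inDx_cvx.
- exact: f2_cvx.
- exact: g2_cvx.
- exact: K2_aff.
- exact: Db.
- have := hmin _ _ Dx; rewrite /svm_objective /f2 /g2 /g1 /=; lra.
by exists ((W, b), us).
Qed.

Lemma inf_attained (A : set R) (v : R) : A v -> (forall w, A w -> v <= w) -> inf A = v.
Proof.
move=> Av h; apply/eqP; rewrite eq_le; apply/andP; split.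
  by apply: ge_inf => //; exists v => w /h.
by apply: lb_le_inf; [exists v|move=> w /h].
Qed.

Lemma F1starE alpha mu s :
  inner_product (ip1 alpha mu) ->
  saddle (ip1 alpha mu) inDx (f1 : Xsp -> R) (g1 : Z1 -> R) (K1 : Xsp -> Z1) s ->
  F1star X y lam1 lam2 lam3 = f1 s.1 + g1 (K1 s.1).
Proof.
case: s => [[W b] us] ipP [/= Ds sP]; apply: inf_attained.
  exists W, b, (margin X W b), W; split; first by split.
  by rewrite /F1 /f1 /g1 /=; lra.
move=> _ [W' [b' [A [U [[-> -> D'] ->]]]]].
have := sP (W', b') (K1 (W', b')) D'; rewrite subrr.
have -> : ip1 alpha mu us 0 = 0 by rewrite -(scale0r us) (ipZr ipP) mul0r.
rewrite /F1 /f1 /g1 /= -/(margin X W' b'); lra.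
Qed.

Lemma F2starE q alpha mu nu s :
  inner_product (ip2 alpha mu nu) ->
  saddle (ip2 alpha mu nu) inDx (f2 : Xsp -> R) (g2 q : Z2 -> R) (K2 : Xsp -> Z2) s ->
  F2star q X y lam1 lam2 lam3 = f2 s.1 + g2 q (K2 s.1).
Proof.
case: s => [[W b] us] ipP [/= Ds sP]; apply: inf_attained.
  exists W, b, (margin X W b), W, W; split; first by split.
  by rewrite /F2 /f2 /g2 /g1 /=; lra.
move=> _ [W' [b' [A [U [V [[-> -> -> D'] ->]]]]]].
have := sP (W', b') (K2 (W', b')) D'; rewrite subrr.
have -> : ip2 alpha mu nu us 0 = 0 by rewrite -(scale0r us) (ipZr ipP) mul0r.
rewrite /F2 /f2 /g2 /g1 /= -/(margin X W' b'); lra.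
Qed.

Lemma frob_cvg0 m k (a : R) (M : nat -> 'M[R]_(m, k)) (e : nat -> R) : 0 < a ->
  (forall i, a * frob2 (M i) <= e i) -> e i @[i --> \oo] --> (0 : R) ->
  frob (M i) @[i --> \oo] --> (0 : R).
Proof.
move=> a0 h e0; rewrite -sqrtr0.
apply: (continuous_cvg _ (@sqrt_continuous R _)).
have e0' : a^-1 * e i @[i --> \oo] --> (0 : R).
  by rewrite -(mulr0 a^-1); apply: cvgM => //; exact: cvg_cst.
apply: (squeeze_cvgr _ (cvg_cst 0) e0'); near=> i.
by rewrite frob2_ge0 /= ler_pdivlMl.
Unshelve. all: by end_near.
Qed.

Lemma P1_convergence alpha mu Wk bk Ak Uk Pik Lamk : 0 < alpha -> 0 < mu ->
  admm1 X y lam1 lam2 lam3 alpha mu Wk bk Ak Uk Pik Lamk ->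
  [/\ F1 y lam1 lam2 lam3 (Wk k) (bk k) (Ak k) (Uk k) @[k --> \oo]
        --> F1star X y lam1 lam2 lam3,
      frob (resid X (Wk k) (bk k) (Ak k)) @[k --> \oo] --> (0 : R) &
      frob (Wk k - Uk k) @[k --> \oo] --> (0 : R)].
Proof.
move=> a0 m0 h; have sq := admm1_seq a0 m0 h.
have ipP := ip1P a0 m0; have [s sP] := P1_saddle a0 m0.
have val := admm_value ipP inDx_cvx f1_cvx g1_cvx K1_aff sq sP.
have res := admm_residual ipP inDx_cvx f1_cvx g1_cvx K1_aff sq sP.
rewrite (F1starE ipP sP); split.
- have -> : (fun k => F1 y lam1 lam2 lam3 (Wk k) (bk k) (Ak k) (Uk k))
     = (fun k => f1 (Wk k, bk k) + g1 (Ak k, Uk k)).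
    by apply/funext => k; rewrite /F1 /f1 /g1 /=; ring.
  exact: val.
- apply: (frob_cvg0 a0 _ res) => k; rewrite residE frob2E.
  by rewrite /ip1 /pair_ip /= lerDl (ip_ge0 (wipP _ _ m0)).
- apply: (frob_cvg0 m0 _ res) => k; rewrite frob2E.
  by rewrite /ip1 /pair_ip /= lerDr (ip_ge0 (wipP _ _ a0)).
Qed.

Lemma P2_convergence q alpha mu nu Wk bk Ak Uk Vk Pik Lamk Gamk :
  0 < alpha -> 0 < mu -> 0 < nu ->
  admm2 q X y lam1 lam2 lam3 alpha mu nu Wk bk Ak Uk Vk Pik Lamk Gamk ->
  [/\ F2 q y lam1 lam2 lam3 (Wk k) (bk k) (Ak k) (Uk k) (Vk k) @[k --> \oo]
        --> F2star q X y lam1 lam2 lam3,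
      frob (resid X (Wk k) (bk k) (Ak k)) @[k --> \oo] --> (0 : R),
      frob (Wk k - Uk k) @[k --> \oo] --> (0 : R) &
      frob (Wk k - Vk k) @[k --> \oo] --> (0 : R)].
Proof.
move=> a0 m0 v0 h; have sq := admm2_seq a0 m0 v0 h.
have ipP := ip2P a0 m0 v0; have [s sP] := P2_saddle q a0 m0 v0.
have val := admm_value ipP inDx_cvx f2_cvx (g2_cvx q) K2_aff sq sP.
have res := admm_residual ipP inDx_cvx f2_cvx (g2_cvx q) K2_aff sq sP.
have pa := ip_ge0 (@wipP R n J _ a0); have pm := ip_ge0 (@wipP R p J _ m0).
have pv := ip_ge0 (@wipP R p J _ v0).
rewrite (F2starE ipP sP); split.
- have -> : (fun k => F2 q y lam1 lam2 lam3 (Wk k) (bk k) (Ak k) (Uk k) (Vk k))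
     = (fun k => f2 (Wk k, bk k) + g2 q ((Ak k, Uk k), Vk k)).
    by apply/funext => k; rewrite /F2 /f2 /g2 /g1 /=; ring.
  exact: val.
- apply: (frob_cvg0 a0 _ res) => k; rewrite residE frob2E.
  have := pm (Wk k - Uk k); have := pv (Wk k - Vk k).
  by rewrite /ip2 /ip1 /pair_ip /wip /=; lra.
- apply: (frob_cvg0 m0 _ res) => k; rewrite frob2E.
  have := pa (margin X (Wk k) (bk k) - Ak k); have := pv (Wk k - Vk k).
  by rewrite /ip2 /ip1 /pair_ip /wip /=; lra.
- apply: (frob_cvg0 v0 _ res) => k; rewrite frob2E.
  have := pa (margin X (Wk k) (bk k) - Ak k); have := pm (Wk k - Uk k).
  by rewrite /ip2 /ip1 /pair_ip /wip /=; lra.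
Qed.

End Instances.

(** * Optimality system of (P1) *)

Section ScalarSubgradient.
Variable R : realType.

(** For [C >= 0] this says that [P] is a subgradient of [C * pospart] at [a]. It is written as signs
    of [P] and of the slack [C - P] plus complementarity, since these survive conformal scaling. *)
Definition hinge_sub (C a P : R) :=
  [/\ 0 <= P, 0 <= C - P, 0 < a -> C - P = 0 & a < 0 -> P = 0].
(** The same encoding for [C] times the absolute value, with slacks [C + L] and [C - L]. *)
Definition abs_sub (C a L : R) :=
  [/\ 0 <= C + L, 0 <= C - L, 0 < a -> C - L = 0 & a < 0 -> C + L = 0].

Lemma pospart_gt0 (a : R) : 0 <= a -> pospart a = a.
Proof. by move=> a0; rewrite /pospart max_l. Qed.

Lemma pospart_le0 (a : R) : a <= 0 -> pospart a = 0.
Proof. by move=> a0; rewrite /pospart max_r. Qed.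

Lemma hinge_subP (C a P : R) : 0 <= C ->
  hinge_sub C a P <-> forall x, P * (x - a) <= C * (pospart x - pospart a).
Proof.
move=> C0; split=> [[h1 h2 h3 h4] x|h].
  have hx : P * x <= C * pospart x.
    case: (leP 0 x) => x0.
      by rewrite pospart_gt0 // ler_wpM2r //; lra.
    by rewrite (pospart_le0 (ltW x0)) mulr0 mulr_ge0_le0 // ltW.
  have [a0|a0|a0] := ltgtP a 0.
  - by move: hx; rewrite (pospart_le0 (ltW a0)) (h4 a0) !mul0r subr0.
  - rewrite (pospart_gt0 (ltW a0)); have := h3 a0; nra.
  - by rewrite a0 (pospart_le0 (lexx 0)) !subr0.
(* By positive homogeneity the points 0 and [2 * a] force [P * a = C * pospart a]; the points
   [a - 1] and [a + 1] supply the bounds on [P] that this leaves open. *)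
have e1 := h (a - 1); have e2 := h (a + 1); have e3 := h 0; have e4 := h (2 * a).
have [a0|a0] := ltP a 0.
  have P0 : P = 0.
    move: e3 e4; rewrite !pospart_le0; nra.
  by split; lra.
rewrite (pospart_gt0 a0) in e1 e2 e3 e4.
have h2 : 0 <= C - P by move: e2; rewrite pospart_gt0; lra.
have [a1|a1] := ltP 0 a.
  have P1 : P = C.
    by move: e3 e4; rewrite (pospart_le0 (lexx 0)) pospart_gt0; nra.
  by split; lra.
have a2 : a = 0 by lra.
split; try lra.
by move: e1; rewrite a2 pospart_le0; lra.
Qed.

Lemma abs_subP (C a L : R) : 0 <= C ->
  abs_sub C a L <-> forall x, L * (x - a) <= C * (`|x| - `|a|).
Proof.
move=> C0; split=> [[h1 h2 h3 h4] x|h].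
  have hx : L * x <= C * `|x| by case: (ler0P x) => x0; nra.
  have [a0|a0|a0] := ltgtP a 0.
  - have -> : `|a| = - a by rewrite ltr0_norm.
    have := h4 a0; nra.
  - have -> : `|a| = a by rewrite gtr0_norm.
    have := h3 a0; nra.
  - by rewrite a0 normr0 !subr0.
have e1 := h (a - 1); have e2 := h (a + 1); have e3 := h 0; have e4 := h (2 * a).
move: e1 e2 e3 e4; rewrite normr0.
have n1 : `|a - 1| <= `|a| + 1 by rewrite (le_trans (ler_normB _ _)) ?normr1.
have n2 : `|a + 1| <= `|a| + 1 by rewrite (le_trans (ler_normD _ _)) ?normr1.
have -> : `|2 * a| = 2 * `|a| by rewrite normrM ger0_norm.
move=> e1 e2 e3 e4; split.
- nra.
- nra.
- move=> a0; move: e3 e4; rewrite (gtr0_norm a0); nra.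
- move=> a0; move: e3 e4; rewrite (ltr0_norm a0); nra.
Qed.

End ScalarSubgradient.

(** * Optimality conditions at saddle points and at the iterates *)

Section KKT.
Variables (R : realType) (n p J : nat) (X : 'M[R]_(p, n)) (y : 'I_n -> 'I_J).
Variables (lam1 lam2 lam3 : R).
Hypotheses (l1 : 0 <= lam1) (l2 : 0 <= lam2) (l3 : 0 < lam3).

Let Xsp : lmodType R := ('M[R]_(p, J) * 'cV[R]_J)%type.
Let Z1 : lmodType R := ('M[R]_(n, J) * 'M[R]_(p, J))%type.
Let ipM m k := @inner_mxP R m k.

Lemma separable_min m k (h : 'I_m -> 'I_k -> R -> R) (M : 'M[R]_(m, k)) :
  (forall M' : 'M[R]_(m, k), \sum_i \sum_j h i j (M i j) <= \sum_i \sum_j h i j (M' i j)) ->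
  forall i j a, h i j (M i j) <= h i j a.
Proof.
move=> hmin i j a.
pose M' : 'M[R]_(m, k) := \matrix_(i', j') if (i', j') == (i, j) then a else M i' j'.
have := hmin M'.
rewrite !pair_big /= (bigD1 (i, j)) //= [leRHS](bigD1 (i, j)) //= mxE eqxx.
suff -> : \sum_(q | q != (i, j)) h q.1 q.2 (M' q.1 q.2)
   = \sum_(q | q != (i, j)) h q.1 q.2 (M q.1 q.2) by rewrite lerD2r.
by apply: eq_bigr => -[i' j'] /negPf ne; rewrite mxE /= ne.
Qed.

Lemma inner_delta m k (G : 'M[R]_(m, k)) i j : inner G (delta_mx i j) = G i j.
Proof.
rewrite innerE pair_big (bigD1 (i, j)) //= mxE !eqxx mulr1 big1 ?addr0 // => -[i' j'] ne.
rewrite mxE /=; case: eqP => [ii|]; rewrite ?mulr0 //=; case: eqP => [jj|]; rewrite ?mulr0 //.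
by rewrite ii jj eqxx in ne.
Qed.

Definition lag_gradW (W : 'M[R]_(p, J)) (Pi : 'M[R]_(n, J)) (Lam : 'M[R]_(p, J)) :=
  lam2 *: W + X *m Pi + Lam.
Definition lag_gradb (b : 'cV[R]_J) (Pi : 'M[R]_(n, J)) : 'cV[R]_J :=
  lam3 *: b + Pi^T *m (const_mx 1 : 'cV[R]_n).

Lemma inner_adjW (P : 'M[R]_(n, J)) (H : 'M[R]_(p, J)) :
  inner P (X^T *m H) = inner (X *m P) H.
Proof. by rewrite /inner trmx_mul mulmxA. Qed.

Lemma inner_adjb (P : 'M[R]_(n, J)) (c : 'cV[R]_J) :
  inner P ((const_mx 1 : 'cV[R]_n) *m c^T) = inner (P^T *m (const_mx 1 : 'cV[R]_n)) c.
Proof.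
rewrite /inner mulmxA mxtrace_mulC -[LHS]mxtrace_tr trmx_mul trmxK //.
Qed.

Lemma lag_grad_inner W b Pi Lam (H : 'M[R]_(p, J)) (c : 'cV[R]_J) :
  inner (lag_gradW W Pi Lam) H + inner (lag_gradb b Pi) c =
  lam2 * inner W H + lam3 * inner b c
  + inner Pi (X^T *m H + (const_mx 1 : 'cV[R]_n) *m c^T) + inner Lam H.
Proof.
rewrite /lag_gradW /lag_gradb !(ipE (ipM _ _)) inner_adjW inner_adjb; ring.
Qed.

Lemma marginB (W W' : 'M[R]_(p, J)) (b b' : 'cV[R]_J) : margin X W' b' - margin X W b
  = X^T *m (W' - W) + (const_mx 1 : 'cV[R]_n) *m (b' - b)^T.
Proof.
rewrite /margin !linearB /= opprD addrACA subrr addr0 opprD addrACA //.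
Qed.

Lemma f1_expand (x : Xsp) (H : 'M[R]_(p, J)) (c : 'cV[R]_J) :
  f1 lam2 lam3 (x + (H, c) : Xsp) = f1 lam2 lam3 x + (lam2 * inner x.1 H + lam3 * inner x.2 c)
   + (lam2 / 2 * frob2 H + lam3 / 2 * frob2 c).
Proof.
rewrite /f1 /= !frob2E !(ipE (ipM _ _)).
rewrite (ipC (ipM _ _) H x.1) (ipC (ipM _ _) c x.2); lra.
Qed.

Variable j0 : 'I_J.

(* The gradient is orthogonal to the subspace D exactly when its rows are constant. *)
Definition stationary (G : 'M[R]_(p, J)) (h : 'cV[R]_J) :=
  (forall i j, G i j = G i j0) /\ (forall j, h j 0 = h j0 0).

(** Moving mass from column [j0] to column [j] stays in the subspace, and such directions compare
    exactly the two entries. *)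
Lemma stationaryP G h : stationary G h <->
  forall H c, inD H c -> inner G H + inner h c = 0.
Proof.
split=> [[hG hh] H c /inDE[hH hc]|hD].
  have -> : inner G H = 0.
    rewrite innerE big1 // => i _; rewrite -[RHS](mulr0 (G i j0)) -[X in _ * X](hH i) mulr_sumr.
    by apply: eq_bigr => j _; rewrite hG.
  rewrite add0r innerE -[RHS](mulr0 (h j0 0)) -[X in _ * X]hc mulr_sumr.
  by apply: eq_bigr => j _; rewrite big_ord1 hh.
have sd m (i : 'I_m) : \sum_i' (i' == i)%:R = 1 :> R.
  by rewrite (bigD1 i) //= eqxx big1 ?addr0 // => i' /negPf ->.
have inner0 m k (G' : 'M[R]_(m, k)) : inner G' 0 = 0.
  by rewrite -(scale0r (0 : 'M[R]_(m, k))) (ipZr (ipM _ _)) mul0r.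
split=> [i j|j].
  have : inD (delta_mx i j - delta_mx i j0 : 'M[R]_(p, J)) 0.
    apply/inDE; split=> [i'|]; last by rewrite big1 // => l _; rewrite mxE.
    under eq_bigr do rewrite !mxE.
    by case: (i' == i) => /=; rewrite sumrB ?sd ?subrr // !big1 ?subrr.
  by move/hD; rewrite (ipDr (ipM _ _)) (ipNr (ipM _ _)) !inner_delta inner0; lra.
have : inD (0 : 'M[R]_(p, J)) (delta_mx j 0 - delta_mx j0 0).
  apply/inDE; split=> [i'|]; first by rewrite big1 // => l _; rewrite mxE.
  under eq_bigr do rewrite !mxE eqxx !andbT.
  by rewrite sumrB !sd subrr.
by move/hD; rewrite (ipDr (ipM _ _)) (ipNr (ipM _ _)) !inner_delta inner0; lra.
Qed.

Definition subgradients (A : 'M[R]_(n, J)) (U : 'M[R]_(p, J)) (Pi : 'M[R]_(n, J))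
    (Lam : 'M[R]_(p, J)) :=
  (forall i j, hinge_sub (n%:R^-1 * cost R y i j) (A i j) (Pi i j)) /\
  (forall i j, abs_sub lam1 (U i j) (Lam i j)).

Let cn_ge0 i j : 0 <= n%:R^-1 * cost R y i j.
Proof. by rewrite mulr_ge0 ?cost_ge0 // invr_ge0 ler0n. Qed.

Lemma hinge_sumE (A : 'M[R]_(n, J)) :
  hinge y A = \sum_i \sum_j n%:R^-1 * cost R y i j * pospart (A i j).
Proof.
rewrite /hinge mulr_sumr; apply: eq_bigr => i _; rewrite mulr_sumr.
by apply: eq_bigr => j _; rewrite mulrA.
Qed.

Lemma subgradientsP A U Pi Lam : subgradients A U Pi Lam <->
  forall A' U', inner Pi (A' - A) + inner Lam (U' - U)
    <= g1 y lam1 (A', U') - g1 y lam1 (A, U).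
Proof.
have l1E (V : 'M[R]_(p, J)) : lam1 * l1norm V = \sum_i \sum_j lam1 * `|V i j|.
  by rewrite /l1norm mulr_sumr; apply: eq_bigr => i _; rewrite mulr_sumr.
have BE m k (F F' : 'I_m -> 'I_k -> R) :
    \sum_i \sum_j F i j - \sum_i \sum_j F' i j = \sum_i \sum_j (F i j - F' i j).
  by rewrite -sumrB; apply: eq_bigr => i _; rewrite -sumrB.
split=> [[hA hU] A' U'|h].
  rewrite /g1 /= opprD addrACA !l1E !hinge_sumE !innerE !BE lerD //.
    apply: ler_sum => i _; apply: ler_sum => j _; rewrite -mulrBr !mxE.
    exact: ((hinge_subP _ _ (cn_ge0 i j)).1 (hA i j)).
  apply: ler_sum => i _; apply: ler_sum => j _; rewrite -mulrBr !mxE.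
  exact: ((abs_subP _ _ l1).1 (hU i j)).
have sep m k (P M M' : 'M[R]_(m, k)) (F : 'I_m -> 'I_k -> R -> R) :
  inner P (M' - M) <= \sum_i \sum_j F i j (M' i j) - \sum_i \sum_j F i j (M i j) ->
  \sum_i \sum_j (F i j (M i j) - P i j * M i j) <=
  \sum_i \sum_j (F i j (M' i j) - P i j * M' i j).
  by rewrite -!BE (ipDr (ipM _ _)) (ipNr (ipM _ _)) !innerE; lra.
split=> i j.
- apply/hinge_subP => // x.
  have := @separable_min _ _
    (fun i j a => n%:R^-1 * cost R y i j * pospart a - Pi i j * a) A _ i j x.
  have H : forall M' : 'M[R]_(n, J),
     \sum_i \sum_j (n%:R^-1 * cost R y i j * pospart (A i j) - Pi i j * A i j)
     <= \sum_i \sum_j (n%:R^-1 * cost R y i j * pospart (M' i j) - Pi i j * M' i j).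
    move=> M'; apply: (sep _ _ _ _ _ (fun i j a => n%:R^-1 * cost R y i j * pospart a)).
    have := h M' U; rewrite subrr -(scale0r (0 : 'M[R]_(p, J))) (ipZr (ipM _ _)) /g1 /= !hinge_sumE.
    lra.
  move/(_ H); lra.
- apply/abs_subP => // x.
  have := @separable_min _ _ (fun i j a => lam1 * `|a| - Lam i j * a) U _ i j x.
  have H : forall M' : 'M[R]_(p, J), \sum_i \sum_j (lam1 * `|U i j| - Lam i j * U i j)
     <= \sum_i \sum_j (lam1 * `|M' i j| - Lam i j * M' i j).
    move=> M'; apply: (sep _ _ _ _ _ (fun i j a => lam1 * `|a|)).
    have := h A M'; rewrite subrr -(scale0r (0 : 'M[R]_(n, J))) (ipZr (ipM _ _)) /g1 /= !l1E.
    lra.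
  move/(_ H); lra.
Qed.

Lemma ip1_scaled alpha mu Pi Lam (z : Z1) : 0 < alpha -> 0 < mu ->
  ip1 alpha mu (alpha^-1 *: Pi, mu^-1 *: Lam) z = inner Pi z.1 + inner Lam z.2.
Proof. by move=> a0 m0; rewrite /ip1 /pair_ip /= !wip_scale. Qed.

Lemma kkt_saddle alpha mu W b Pi Lam : 0 < alpha -> 0 < mu -> inD W b ->
  stationary (lag_gradW W Pi Lam) (lag_gradb b Pi) ->
  subgradients (margin X W b) W Pi Lam ->
  saddle (ip1 alpha mu) (@inDx R p J) (f1 lam2 lam3 : Xsp -> R) (g1 y lam1 : Z1 -> R)
    (K1 X : Xsp -> Z1) ((W, b), (alpha^-1 *: Pi, mu^-1 *: Lam)).
Proof.
move=> a0 m0 Db /stationaryP st /subgradientsP sg; split => //= -[W' b'] [A' U'] D'.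
rewrite ip1_scaled //=; have := sg A' U'.
have dD : inD (W' - W) (b' - b).
  case: Db D' => [h1 h2] [/= h3 h4]; split.
    by rewrite mulmxBl h1 h3 subrr.
  by rewrite mulmxBr h2 h4 subrr.
have := st _ _ dD; rewrite lag_grad_inner -marginB.
have -> : ((W', b') : Xsp) = ((W, b) : Xsp) + (W' - W, b' - b).
  by congr pair; rewrite /= addrC subrK.
rewrite f1_expand /= !(ipDr (ipM _ _)) !(ipNr (ipM _ _)).
have : 0 <= lam2 / 2 * frob2 (W' - W) by rewrite mulr_ge0 ?frob2_ge0 ?divr_ge0.
have : 0 <= lam3 / 2 * frob2 (b' - b) by rewrite mulr_ge0 ?frob2_ge0 ?divr_ge0 // ltW.
rewrite /K1 /=; lra.
Qed.

Section Iterates.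
Variables (alpha mu : R).
Hypotheses (a0 : 0 < alpha) (m0 : 0 < mu).
Variables (Wk : nat -> 'M[R]_(p, J)) (bk : nat -> 'cV[R]_J) (Ak : nat -> 'M[R]_(n, J))
  (Uk : nat -> 'M[R]_(p, J)) (Pik : nat -> 'M[R]_(n, J)) (Lamk : nat -> 'M[R]_(p, J)).
Hypothesis seqP : admm1 X y lam1 lam2 lam3 alpha mu Wk bk Ak Uk Pik Lamk.

Let sq := admm1_seq a0 m0 seqP.

Lemma iterate_subgradients k : subgradients (Ak k.+1) (Uk k.+1) (Pik k.+1) (Lamk k.+1).
Proof.
apply/subgradientsP => A' U'.
have := z_vi (ip1P n p J a0 m0) (g1_cvx y l1) sq k (A', U').
rewrite ip1_scaled //=; lra.
Qed.

(** Stationarity is exact for multipliers shifted by the last increments of [A] and [U], so for the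
    true multipliers its defect is of the order of the last step. *)
Lemma iterate_stationary k : stationary
  (lag_gradW (Wk k.+1) (Pik k.+1 + alpha *: (Ak k.+1 - Ak k))
     (Lamk k.+1 + mu *: (Uk k.+1 - Uk k)))
  (lag_gradb (bk k.+1) (Pik k.+1 + alpha *: (Ak k.+1 - Ak k))).
Proof.
apply/stationaryP => H c Dc; rewrite lag_grad_inner.
have Dk : inD (Wk k.+1) (bk k.+1) by case: (seqP k) => -[].
set Pt := Pik k.+1 + _; set Lt := Lamk k.+1 + _; set S := (X in X = 0).
(* The constraint set is a subspace, so [s] may have either sign, and the linear coefficient [S]
   must vanish. *)
have key s : 0 <= s * S + s ^+ 2 * (lam2 / 2 * frob2 H + lam3 / 2 * frob2 c).
  have Dx : inDx ((Wk k.+1, bk k.+1) + s *: ((H, c) : Xsp) : Xsp).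
    case: Dk Dc => [h1 h2] [h3 h4]; split => /=.
      by rewrite mulmxDl -scalemxAl h1 h3 scaler0 addr0.
    by rewrite mulmxDr -scalemxAr h2 h4 scaler0 addr0.
  have := x_vi (ip1P n p J a0 m0) (@inDx_cvx R p J) (f1_cvx l2 l3) (K1_aff X) sq k Dx.
  have -> : ((alpha^-1 *: Pik k.+1, mu^-1 *: Lamk k.+1) +
      ((Ak k.+1, Uk k.+1) - (Ak k, Uk k)) : Z1) = (alpha^-1 *: Pt, mu^-1 *: Lt).
    by congr pair; rewrite /= /Pt /Lt scalerDr scalerA mulVf ?scale1r // gt_eqF.
  rewrite ip1_scaled //=.
  have -> : s *: ((H, c) : Xsp) = (s *: H, s *: c) by [].
  rewrite f1_expand /= marginB.
  rewrite [Wk k.+1 + _]addrC [bk k.+1 + _]addrC !addrK.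
  rewrite !linearZ /= -?scalemxAr -scalerDr !frob2E !(ipZr (ipM _ _)) !(ipZl (ipM _ _)) /S.
  lra.
apply/eqP; rewrite eq_le -oppr_ge0; apply/andP; split.
  apply: (@first_order_ge0 R _ (lam2 / 2 * frob2 H + lam3 / 2 * frob2 c)) => t _.
  by have := key (- t); rewrite sqrrN mulNr mulrN.
by apply: (@first_order_ge0 R _ (lam2 / 2 * frob2 H + lam3 / 2 * frob2 c)) => t _; exact: key.
Qed.

End Iterates.
End KKT.

(** * Error bound *)

Section LinearFunctionals.
Variables (R : realType) (I : Type).
Implicit Types phi psi : (I -> R) -> R.

Definition linI phi := forall a s t, phi (fun i => a * s i + t i) = a * phi s + phi t.

Lemma linI_coord i : linI (fun t => t i).
Proof. by []. Qed.

Lemma linI_add phi psi : linI phi -> linI psi -> linI (fun t => phi t + psi t).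
Proof. by move=> h1 h2 a s t; rewrite h1 h2; ring. Qed.

Lemma linI_scale c phi : linI phi -> linI (fun t => c * phi t).
Proof. by move=> h a s t; rewrite h; ring. Qed.

Lemma linI_sub phi psi : linI phi -> linI psi -> linI (fun t => phi t - psi t).
Proof. by move=> h1 h2 a s t; rewrite h1 h2; ring. Qed.

Lemma linI_sum (T : finType) (phi : T -> (I -> R) -> R) :
  (forall j, linI (phi j)) -> linI (fun t => \sum_j phi j t).
Proof.
move=> h a s t; rewrite mulr_sumr -big_split /=; apply: eq_bigr => j _; exact: h.
Qed.

End LinearFunctionals.

Section ErrorBound.
Variables (R : realType) (n p J : nat) (X : 'M[R]_(p, n)) (y : 'I_n -> 'I_J).
Variables (lam1 lam2 lam3 : R) (j0 : 'I_J).

(* The blocks are W, b, A, U, Pi, the slack c/n - Pi, lam1 + Lam, lam1 - Lam and a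
   homogenizing coordinate. *)
Let PJ := ('I_p * 'I_J)%type.
Let NJ := ('I_n * 'I_J)%type.
Let I := ((((PJ + 'I_J) + (NJ + PJ)) + ((NJ + NJ) + (PJ + PJ))) + unit)%type.
Let iW i j : I := inl (inl (inl (inl (i, j)))).
Let ib j : I := inl (inl (inl (inr j))).
Let iA i j : I := inl (inl (inr (inl (i, j)))).
Let iU i j : I := inl (inl (inr (inr (i, j)))).
Let iP i j : I := inl (inr (inl (inl (i, j)))).
Let iS i j : I := inl (inr (inl (inr (i, j)))).
Let iT i j : I := inl (inr (inr (inl (i, j)))).
Let iV i j : I := inl (inr (inr (inr (i, j)))).
Let i1 : I := inr tt.
Let O := (((NJ + PJ) + ('I_p + unit)) + ((PJ + 'I_J) + (NJ + PJ)))%type.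
Let cn i j := n%:R^-1 * cost R y i j.

Let Gexp (t : I -> R) i j :=
  lam2 * t (iW i j) + \sum_l X i l * t (iP l j) + (t (iT i j) - lam1 * t i1).
Let hexp (t : I -> R) j := lam3 * t (ib j) + \sum_l t (iP l j).

(** In order: margin equation, [W = U], the two conditions of [inD], stationarity in [W] and [b],
    and the identities tying each multiplier to its slacks. A kernel vector with [t i1 = 1] solves
    all the equalities of the optimality system; signs and complementarity are left to
    conformity. *)
Let ell (o : O) (t : I -> R) : R := match o with
  | inl (inl (inl (i, j))) => \sum_k X k i * t (iW k j) + t (ib j) + t i1 - t (iA i j)
  | inl (inl (inr (i, j))) => t (iW i j) - t (iU i j)
  | inl (inr (inl i)) => \sum_j t (iW i j)
  | inl (inr (inr _)) => \sum_j t (ib j)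
  | inr (inl (inl (i, j))) => Gexp t i j - Gexp t i j0
  | inr (inl (inr j)) => hexp t j - hexp t j0
  | inr (inr (inl (i, j))) => t (iP i j) + t (iS i j) - cn i j * t i1
  | inr (inr (inr (i, j))) => t (iT i j) + t (iV i j) - 2 * lam1 * t i1
  end.

Let Gexp_lin i j : linI (fun t => Gexp t i j).
Proof.
apply: linI_add; first apply: linI_add.
- by apply: linI_scale; exact: linI_coord.
- by apply: linI_sum => l; apply: linI_scale; exact: linI_coord.
- by apply: linI_sub; [|apply: linI_scale]; exact: linI_coord.
Qed.

Let hexp_lin j : linI (fun t => hexp t j).
Proof.
apply: linI_add; first by apply: linI_scale; exact: linI_coord.
by apply: linI_sum => l; exact: linI_coord.
Qed.

Let ell_lin : linfam ell.
Proof.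
move=> [[[[i j]|[i j]]|[i|u]]|[[[i j]|j]|[[i j]|[i j]]]].
- apply: linI_sub; last exact: linI_coord.
  apply: linI_add; last exact: linI_coord.
  apply: linI_add; last exact: linI_coord.
  by apply: linI_sum => l; apply: linI_scale; exact: linI_coord.
- by apply: linI_sub; exact: linI_coord.
- by apply: linI_sum => l; exact: linI_coord.
- by apply: linI_sum => l; exact: linI_coord.
- by apply: linI_sub; exact: Gexp_lin.
- by apply: linI_sub; exact: hexp_lin.
- apply: linI_sub; last by apply: linI_scale; exact: linI_coord.
  by apply: linI_add; exact: linI_coord.
- apply: linI_sub; last by apply: linI_scale; exact: linI_coord.
  by apply: linI_add; exact: linI_coord.
Qed.

Lemma lag_gradWE (W : 'M[R]_(p, J)) (Pi : 'M[R]_(n, J)) (Lam : 'M[R]_(p, J)) i j :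
  lag_gradW X lam2 W Pi Lam i j = lam2 * W i j + \sum_l X i l * Pi l j + Lam i j.
Proof. by rewrite !mxE. Qed.

Lemma lag_gradbE (b : 'cV[R]_J) (Pi : 'M[R]_(n, J)) j :
  lag_gradb lam3 b Pi j 0 = lam3 * b j 0 + \sum_l Pi l j.
Proof. by rewrite !mxE; congr (_ + _); apply: eq_bigr => l _; rewrite !mxE mulr1. Qed.

(* Complementarity survives passing from t to the kernel vector th * t, because the
   latter has the same signs and no larger support. *)
Lemma kkt_error_bound : exists2 kap : R, 0 <= kap &
  forall (W : 'M[R]_(p, J)) (b : 'cV[R]_J) (A : 'M[R]_(n, J)) (U : 'M[R]_(p, J))
    (Pi : 'M[R]_(n, J)) (Lam : 'M[R]_(p, J)) (eta : R),
  inD W b -> subgradients y lam1 A U Pi Lam ->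
  (forall i j, `|margin X W b i j - A i j| <= eta) ->
  (forall i j, `|W i j - U i j| <= eta) ->
  (forall i j, `|lag_gradW X lam2 W Pi Lam i j - lag_gradW X lam2 W Pi Lam i j0| <= eta) ->
  (forall j, `|lag_gradb lam3 b Pi j 0 - lag_gradb lam3 b Pi j0 0| <= eta) ->
  0 <= eta -> kap * eta <= 1 / 2 ->
  exists Ws bs Pis Lams,
   [/\ inD Ws bs,
       stationary j0 (lag_gradW X lam2 Ws Pis Lams) (lag_gradb lam3 bs Pis),
       subgradients y lam1 (margin X Ws bs) Ws Pis Lams &
       [/\ forall i j, `|A i j - margin X Ws bs i j| <= kap * eta * (1 + 2 * `|A i j|),
           forall i j, `|U i j - Ws i j| <= kap * eta * (1 + 2 * `|U i j|),
           forall i j, `|Pi i j - Pis i j| <= kap * eta * (1 + 2 * `|Pi i j|) &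
           forall i j, `|Lam i j - Lams i j| <= kap * eta * (1 + 2 * `|lam1 + Lam i j|)]].
Proof.
have [kap kap0 kapP] := conformal_decomp ell_lin.
(* [linsize] adds up all the defects, each of which is at most [eta]. *)
exists (kap * #|{: O}|%:R); first by rewrite mulr_ge0 ?ler0n.
move=> W b A U Pi Lam eta /inDE[hW hb] [sA sU] e1 e2 e3 e4 eta0 small.
pose t (i : I) : R := match i with
  | inl (inl (inl (inl (i, j)))) => W i j
  | inl (inl (inl (inr j))) => b j 0
  | inl (inl (inr (inl (i, j)))) => A i j
  | inl (inl (inr (inr (i, j)))) => U i j
  | inl (inr (inl (inl (i, j)))) => Pi i j
  | inl (inr (inl (inr (i, j)))) => cn i j - Pi i j
  | inl (inr (inr (inl (i, j)))) => lam1 + Lam i j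
  | inl (inr (inr (inr (i, j)))) => lam1 - Lam i j
  | inr _ => 1 end.
have GE i j : Gexp t i j = lag_gradW X lam2 W Pi Lam i j.
  by rewrite lag_gradWE /Gexp /=; ring.
have hE j : hexp t j = lag_gradb lam3 b Pi j 0 by rewrite lag_gradbE.
have size_t : linsize ell t <= #|{: O}|%:R * eta.
  rewrite mulr_natl -sumr_const; apply: ler_sum.
  move=> [[[[i j]|[i j]]|[i|u]]|[[[i j]|j]|[[i j]|[i j]]]] _.
  - by have := e1 i j; rewrite marginE.
  - exact: e2.
  - by rewrite /ell hW normr0.
  - by rewrite /ell hb normr0.
  - by rewrite /ell !GE.
  - by rewrite /ell !hE.
  - have -> : ell (inr (inr (inl (i, j)))) t = 0 by rewrite /= mulr1; ring.
    by rewrite normr0.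
  - have -> : ell (inr (inr (inr (i, j)))) t = 0 by rewrite /= mulr1; ring.
    by rewrite normr0.
have [th [th01 ker bnd]] := kapP t.
set K := kap * #|{: O}|%:R in small *.
have {}bnd i : `|t i - th i * t i| <= K * eta.
  by apply: le_trans (bnd i) _; rewrite /K -mulrA ler_wpM2l.
have t1 : t i1 = 1 by [].
(* Smallness of the defects is used here: the homogenizing coordinate stays away from 0, and
   dividing by it restores the value 1. *)
have th1 : 1 / 2 <= th i1.
  by have := bnd i1; rewrite t1 mulr1 ler_norml; lra.
have th0 : 0 < th i1 by lra.
pose s i := th i * t i / th i1.
have s1 : s i1 = 1 by rewrite /s t1 mulr1 divff // gt_eqF.
have ells o : ell o s = 0.
  have := ell_lin o (th i1)^-1 (fun i => th i * t i) (fun=> 0).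
  rewrite ker (ell0 ell_lin) mulr0 addr0 => <-; congr ell.
  by apply/funext => i; rewrite addr0 mulrC.
(* The term 1 is the decomposition error; [2 * |t i|] is the cost of dividing by [th i1], which is
   within [K * eta] of 1 and at least 1/2. *)
have sdist i : `|t i - s i| <= K * eta * (1 + 2 * `|t i|).
  have -> : t i - s i = (t i - th i * t i) + (th i * t i) * ((th i1 - 1) / th i1).
    by rewrite /s; field; rewrite gt_eqF.
  apply: le_trans (ler_normD _ _) _; rewrite mulrDr mulr1 lerD // normrM.
  have h1 : `|th i * t i| <= `|t i|.
    have /andP[a b'] := th01 i; rewrite normrM (ger0_norm a).
    by have := normr_ge0 (t i); nra.
  have h2 : `|(th i1 - 1) / th i1| <= 2 * (K * eta).
    rewrite normrM [X in _ * X]gtr0_norm ?invr_gt0 // ler_pdivrMr //.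
    have := bnd i1; rewrite t1 mulr1 distrC => h; have := normr_ge0 (th i1 - 1); nra.
  have -> : K * eta * (2 * `|t i|) = `|t i| * (2 * (K * eta)) by ring.
  by rewrite ler_pM.
have sge0 i : 0 <= t i -> 0 <= s i.
  by move=> ti; have /andP[a _] := th01 i; rewrite /s divr_ge0 ?mulr_ge0 // ltW.
have sgt0 i : 0 < s i -> 0 < t i.
  move=> si; rewrite ltNge; apply/negP => ti.
  suff : s i <= 0 by rewrite leNgt si.
  by have /andP[a _] := th01 i; rewrite /s mulr_le0_ge0 ?mulr_ge0_le0 // invr_ge0 ltW.
have slt0 i : s i < 0 -> t i < 0.
  by move=> si; rewrite ltNge; apply/negP => /sge0; rewrite leNgt si.
have seq0 i : t i = 0 -> s i = 0 by move=> ti; rewrite /s ti mulr0 mul0r.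
pose Ws : 'M[R]_(p, J) := \matrix_(i, j) s (iW i j).
pose bs : 'cV[R]_J := \col_j s (ib j).
pose Pis : 'M[R]_(n, J) := \matrix_(i, j) s (iP i j).
pose Lams : 'M[R]_(p, J) := \matrix_(i, j) (s (iT i j) - lam1).
have sW i j : s (iU i j) = Ws i j.
  by have := ells (inl (inl (inr (i, j)))) => /=; rewrite mxE; lra.
have sM i j : s (iA i j) = margin X Ws bs i j.
  have := ells (inl (inl (inl (i, j)))); rewrite /ell marginE s1 [bs j 0]mxE.
  have -> : \sum_k X k i * Ws k j = \sum_k X k i * s (iW k j).
    by apply: eq_bigr => k _; rewrite mxE.
  lra.
exists Ws, bs, Pis, Lams; split.
- apply/inDE; split=> [i|].
    by rewrite -[RHS](ells (inl (inr (inl i)))); apply: eq_bigr => j _; rewrite mxE.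
  by rewrite -[RHS](ells (inl (inr (inr tt)))); apply: eq_bigr => j _; rewrite mxE.
- have GsE i j : lag_gradW X lam2 Ws Pis Lams i j = Gexp s i j.
    rewrite lag_gradWE /Gexp s1 mulr1 !mxE; congr (_ + _ + _).
    by apply: eq_bigr => l _; rewrite mxE.
  have hsE j : lag_gradb lam3 bs Pis j 0 = hexp s j.
    rewrite lag_gradbE /hexp !mxE; congr (_ + _).
    by apply: eq_bigr => l _; rewrite mxE.
  split=> [i j|j].
    by have := ells (inr (inl (inl (i, j)))); rewrite /ell !GsE; lra.
  by have := ells (inr (inl (inr j))); rewrite /ell !hsE; lra.
- split=> i j.
    have [p1 p2 p3 p4] := sA i j.
    have := ells (inr (inr (inl (i, j)))); rewrite /ell s1 mulr1 => E.
    rewrite -sM mxE -/(cn i j).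
    have E' : cn i j - s (iP i j) = s (iS i j) by lra.
    rewrite /hinge_sub E'; split; first exact: sge0.
    + by apply: sge0.
    + by move/sgt0/p3 => h; exact: seq0.
    + by move/slt0/p4 => h; exact: seq0.
  have [p1 p2 p3 p4] := sU i j.
  have := ells (inr (inr (inr (i, j)))); rewrite /ell s1 mulr1 => E.
  rewrite -sW mxE.
  have E1 : lam1 + (s (iT i j) - lam1) = s (iT i j) by ring.
  have E2 : lam1 - (s (iT i j) - lam1) = s (iV i j) by lra.
  rewrite /abs_sub E1 E2; split; first exact: sge0.
  + by apply: sge0.
  + by move/sgt0/p3 => h; exact: seq0.
  + by move/slt0/p4 => h; exact: seq0.
- split=> i j.
  + by rewrite -sM; exact: (sdist (iA i j)).
  + by rewrite -sW; exact: (sdist (iU i j)).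
  + by rewrite mxE; exact: (sdist (iP i j)).
  + have -> : Lam i j - Lams i j = t (iT i j) - s (iT i j) by rewrite mxE /=; ring.
    exact: (sdist (iT i j)).
Qed.

End ErrorBound.

(** * Linear convergence *)

Section Geometric.
Variables (R : realType) (r : R).
Hypotheses (r0 : 0 < r) (r1 : r < 1).

(** The rate is fixed but the limit and constant are not, so the class is closed under the linear
    operations that later express [W] and [b] through the other blocks. *)
Definition geometric_cvg (a : nat -> R) := exists l C, forall k, `|a k - l| <= C * r ^+ k.

Let rk k : 0 < r ^+ k. Proof. exact: exprn_gt0. Qed.

Lemma geometric_of_shift (a : nat -> R) (N : nat) :
  geometric_cvg (fun k => a (N + k)%N) -> geometric_cvg a.
Proof.
elim: N a => [//|N IH] a [l [C h]].
apply: IH; exists l, (`|a N - l| + C / r) => -[|k].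
  have C0 : 0 <= C by have := h 0; rewrite expr0 mulr1; apply: le_trans; exact: normr_ge0.
  by rewrite addn0 expr0 mulr1 lerDl divr_ge0 // ltW.
rewrite addnS -addSn; apply: le_trans (h k) _.
have -> : (`|a N - l| + C / r) * r ^+ k.+1 = `|a N - l| * r ^+ k.+1 + C * r ^+ k.
  by rewrite exprS; field; rewrite gt_eqF.
by rewrite lerDr mulr_ge0 // ltW.
Qed.

Lemma geometric_shift (a : nat -> R) : geometric_cvg a -> geometric_cvg (fun k => a k.+1).
Proof.
by move=> [l [C h]]; exists l, (C * r) => k; have := h k.+1; rewrite exprS mulrA.
Qed.

Lemma geometric_cst (c : R) : geometric_cvg (fun=> c).
Proof. by exists c, 0 => k; rewrite subrr normr0 mul0r. Qed.

Lemma geometric_add a b : geometric_cvg a -> geometric_cvg b ->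
  geometric_cvg (fun k => a k + b k).
Proof.
move=> [l [C h]] [l' [C' h']]; exists (l + l'), (C + C') => k.
rewrite opprD addrACA mulrDl; apply: le_trans (ler_normD _ _) _; exact: lerD.
Qed.

Lemma geometric_scale c a : geometric_cvg a -> geometric_cvg (fun k => c * a k).
Proof.
move=> [l [C h]]; exists (c * l), (`|c| * C) => k.
by rewrite -mulrBr normrM -mulrA ler_wpM2l.
Qed.

Lemma geometric_sub a b : geometric_cvg a -> geometric_cvg b ->
  geometric_cvg (fun k => a k - b k).
Proof.
move=> ha hb; have := geometric_add ha (geometric_scale (-1) hb).
by congr geometric_cvg; apply/funext => k; rewrite mulN1r.
Qed.

Lemma geometric_sum (T : finType) (a : T -> nat -> R) :
  (forall j, geometric_cvg (a j)) -> geometric_cvg (fun k => \sum_j a j k).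
Proof.
move=> h; elim: (index_enum T) => [|j s IH].
  have -> : (fun k => \sum_(j <- [::]) a j k) = (fun=> 0).
    by apply/funext => k; rewrite big_nil.
  exact: geometric_cst.
have -> : (fun k => \sum_(j <- j :: s) a j k) = (fun k => a j k + \sum_(j <- s) a j k).
  by apply/funext => k; rewrite big_cons.
exact: geometric_add.
Qed.

(* The sequences a k + c r^k and a k - c r^k, with c = C / (1 - r), are monotone. *)
Lemma geometric_increments (a : nat -> R) (C : R) :
  (forall k, `|a k.+1 - a k| <= C * r ^+ k) -> geometric_cvg a.
Proof.
move=> h; pose c := C / (1 - r).
have cE : C = c * (1 - r) by rewrite /c divfK // gt_eqF // subr_gt0.
pose up k := a k + c * r ^+ k; pose lo k := a k - c * r ^+ k.
have C0 : 0 <= C by have := h 0; rewrite expr0 mulr1; apply: le_trans; exact: normr_ge0.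
have c0 : 0 <= c by rewrite divr_ge0 // subr_ge0 ltW.
have upS k : up k.+1 <= up k.
  by have := h k; rewrite ler_norml /up exprS cE => /andP[_]; lra.
have loS k : lo k <= lo k.+1.
  by have := h k; rewrite ler_norml /lo exprS cE => /andP[+ _]; lra.
have upD k m : up (k + m)%N <= up k.
  by elim: m => [|m IH]; rewrite ?addn0 // addnS; apply: le_trans (upS _) IH.
have loD k m : lo k <= lo (k + m)%N.
  by elim: m => [|m IH]; rewrite ?addn0 // addnS; apply: le_trans IH (loS _).
have loup k : lo k <= up k.
  by have := mulr_ge0 c0 (ltW (rk k)); rewrite /lo /up; lra.
have cross k m : lo k <= up m.
  apply: le_trans (loD k m) _; apply: le_trans (loup _) _.
  by rewrite addnC.
pose l := inf (range up).
have hlo k : lo k <= l.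
  by apply: lb_le_inf; [exists (up 0%N), 0%N|move=> _ [m _ <-]].
have hup k : l <= up k.
  by apply: ge_inf; [exists (lo 0%N) => _ [m _ <-]|exists k].
exists l, c => k; rewrite ler_norml.
by have := hlo k; have := hup k; rewrite /lo /up; lra.
Qed.

Lemma frob_le_l1norm m k (M : 'M[R]_(m, k)) : frob M <= l1norm M.
Proof.
rewrite -(ger0_norm (l1norm_ge0 M)) -sqrtr_sqr ler_wsqrtr //.
rewrite expr2 /frob2 {1}/l1norm mulr_suml; apply: ler_sum => i _.
rewrite mulr_suml; apply: ler_sum => j _.
by rewrite -(real_normK (num_real (M i j))) expr2 ler_wpM2l // entry_le_l1norm.
Qed.

Lemma geometric_matrix m k (M : nat -> 'M[R]_(m, k)) :
  (forall i j, geometric_cvg (fun s => M s i j)) ->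
  exists L C, forall s, frob (M s - L) <= C * r ^+ s.
Proof.
move=> h.
have hij (ij : 'I_m * 'I_k) : exists l C, forall s, `|M s ij.1 ij.2 - l| <= C * r ^+ s.
  by case: ij => i j; exact: h.
have [L LP] := choice hij.
have [C CP] := choice LP.
exists (\matrix_(i, j) L (i, j)), (\sum_i \sum_j C (i, j)) => s.
apply: le_trans (frob_le_l1norm _) _.
rewrite /l1norm mulr_suml; apply: ler_sum => i _; rewrite mulr_suml; apply: ler_sum => j _.
by rewrite !mxE; exact: (CP (i, j)).
Qed.

End Geometric.

(** * Rate of the (P1) iterates *)

Section LinearRate.
Variables (R : realType) (n p J : nat) (X : 'M[R]_(p, n)) (y : 'I_n -> 'I_J).
Variables (lam1 lam2 lam3 : R).
Hypotheses (l1 : 0 <= lam1) (l2 : 0 <= lam2) (l3 : 0 < lam3).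
Variables (i0 : 'I_n) (j0 : 'I_J).
Variables (alpha mu : R).
Hypotheses (a0 : 0 < alpha) (m0 : 0 < mu).
Variables (Wk : nat -> 'M[R]_(p, J)) (bk : nat -> 'cV[R]_J) (Ak : nat -> 'M[R]_(n, J))
  (Uk : nat -> 'M[R]_(p, J)) (Pik : nat -> 'M[R]_(n, J)) (Lamk : nat -> 'M[R]_(p, J)).
Hypothesis seqP : admm1 X y lam1 lam2 lam3 alpha mu Wk bk Ak Uk Pik Lamk.

Let Xsp : lmodType R := ('M[R]_(p, J) * 'cV[R]_J)%type.
Let Z1 : lmodType R := ('M[R]_(n, J) * 'M[R]_(p, J))%type.
Let zk k : Z1 := (Ak k, Uk k).
Let uk k : Z1 := (alpha^-1 *: Pik k, mu^-1 *: Lamk k).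
Let ip : Z1 -> Z1 -> R := ip1 alpha mu.
Let sad := saddle ip (@inDx R p J) (f1 lam2 lam3 : Xsp -> R) (g1 y lam1 : Z1 -> R)
    (K1 X : Xsp -> Z1).
Let step k := step_size ip zk uk k.
Let ipP := ip1P n p J a0 m0.
Let sq := admm1_seq a0 m0 seqP.
Let n0 : (0 < n)%N := leq_ltn_trans (leq0n i0) (ltn_ord i0).

(** Dominates both inverse penalties. Being at least 1, it also satisfies [c0 <= c0 ^ 2], so it can
    be pulled out of a square root without taking its own root. *)
Let c0 := 1 + alpha^-1 + mu^-1.

Let c0_ge0 : 0 <= c0.
Proof. by rewrite /c0 !addr_ge0 ?invr_ge0 ?ltW. Qed.

Let entry_bound m k (a s : R) (M : 'M[R]_(m, k)) i j : 0 < a -> a^-1 <= c0 ->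
  wip a M M <= s -> `|M i j| <= c0 * Num.sqrt s.
Proof.
move=> ha hac hs.
have h : a * M i j ^+ 2 <= s.
  apply: le_trans hs; rewrite /wip -frob2E ler_pM2l //; exact: entry_le_frob2.
have c1 : 1 <= c0 by rewrite /c0 -addrA lerDl addr_ge0 ?invr_ge0 ?ltW.
have s0 : 0 <= s by apply: le_trans h; rewrite mulr_ge0 ?sqr_ge0 // ltW.
rewrite -(ger0_norm c0_ge0) -!sqrtr_sqr -sqrtrM ?sqr_ge0 // ler_wsqrtr //.
have : M i j ^+ 2 <= a^-1 * s by rewrite ler_pdivlMl.
move/le_trans; apply; rewrite ler_wpM2r //; apply: le_trans hac _.
by rewrite expr2 ler_peMl.
Qed.

Let alpha_c0 : alpha^-1 <= c0.
Proof. by rewrite /c0; have := ltW m0; rewrite -invr_ge0; lra. Qed.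

Let mu_c0 : mu^-1 <= c0.
Proof. by rewrite /c0; have := ltW a0; rewrite -invr_ge0; lra. Qed.

Let wip_ge0 m k (a : R) (M : 'M[R]_(m, k)) : 0 < a -> 0 <= wip a M M.
Proof. by move=> ha; exact: (ip_ge0 (wipP _ _ ha)). Qed.

Let stepE k : step k = wip alpha (alpha^-1 *: Pik k.+1 - alpha^-1 *: Pik k)
     (alpha^-1 *: Pik k.+1 - alpha^-1 *: Pik k)
   + wip mu (mu^-1 *: Lamk k.+1 - mu^-1 *: Lamk k) (mu^-1 *: Lamk k.+1 - mu^-1 *: Lamk k)
   + (wip alpha (Ak k.+1 - Ak k) (Ak k.+1 - Ak k)
   + wip mu (Uk k.+1 - Uk k) (Uk k.+1 - Uk k)).
Proof. by []. Qed.

Let step_parts k :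
  [/\ wip alpha (Ak k.+1 - Ak k) (Ak k.+1 - Ak k) <= step k,
      wip mu (Uk k.+1 - Uk k) (Uk k.+1 - Uk k) <= step k,
      wip alpha (alpha^-1 *: Pik k.+1 - alpha^-1 *: Pik k)
        (alpha^-1 *: Pik k.+1 - alpha^-1 *: Pik k) <= step k &
      wip mu (mu^-1 *: Lamk k.+1 - mu^-1 *: Lamk k)
        (mu^-1 *: Lamk k.+1 - mu^-1 *: Lamk k) <= step k].
Proof.
have w1 := wip_ge0 (Ak k.+1 - Ak k) a0.
have w2 := wip_ge0 (Uk k.+1 - Uk k) m0.
have w3 := wip_ge0 (alpha^-1 *: Pik k.+1 - alpha^-1 *: Pik k) a0.
have w4 := wip_ge0 (mu^-1 *: Lamk k.+1 - mu^-1 *: Lamk k) m0.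
by rewrite stepE; split; lra.
Qed.

Let incA k i j : `|(Ak k.+1 - Ak k) i j| <= c0 * Num.sqrt (step k).
Proof. by have [h _ _ _] := step_parts k; exact: entry_bound a0 alpha_c0 h. Qed.

Let incU k i j : `|(Uk k.+1 - Uk k) i j| <= c0 * Num.sqrt (step k).
Proof. by have [_ h _ _] := step_parts k; exact: entry_bound m0 mu_c0 h. Qed.

Let incP k i j :
  `|(alpha^-1 *: Pik k.+1 - alpha^-1 *: Pik k) i j| <= c0 * Num.sqrt (step k).
Proof. by have [_ _ h _] := step_parts k; exact: entry_bound a0 alpha_c0 h. Qed.

Let incL k i j :
  `|(mu^-1 *: Lamk k.+1 - mu^-1 *: Lamk k) i j| <= c0 * Num.sqrt (step k).
Proof. by have [_ _ _ h] := step_parts k; exact: entry_bound m0 mu_c0 h. Qed.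

Let residA k : margin X (Wk k.+1) (bk k.+1) - Ak k.+1
  = alpha^-1 *: Pik k.+1 - alpha^-1 *: Pik k.
Proof.
have [_ _ -> _] := seqP k; rewrite residE scalerDr scalerA mulVf ?gt_eqF // scale1r.
by rewrite [RHS]addrC addKr.
Qed.

Let residU k : Wk k.+1 - Uk k.+1 = mu^-1 *: Lamk k.+1 - mu^-1 *: Lamk k.
Proof.
have [_ _ _ ->] := seqP k; rewrite scalerDr scalerA mulVf ?gt_eqF // scale1r.
by rewrite [RHS]addrC addKr.
Qed.

(** One constant for all residuals: 1 for the primal ones, then the effect of the multiplier shift
    on the gradients in [W] and in [b], each doubled because two entries are compared. *)
Let cX := 1 + 2 * (l1norm X * alpha + mu) + 2 * (n%:R * alpha).

Let cX_ge1 : 1 <= cX.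
Proof.
have h1 := mulr_ge0 (l1norm_ge0 X) (ltW a0); have h2 := mulr_ge0 (ler0n R n) (ltW a0).
by rewrite /cX; have := m0; lra.
Qed.

Let row_abs_sum i : \sum_l `|X i l| <= l1norm X.
Proof. by rewrite /l1norm (bigD1 i) //= lerDl sumr_ge0 // => i' _; rewrite sumr_ge0. Qed.

Let gradW_residual k i j :
  `|lag_gradW X lam2 (Wk k.+1) (Pik k.+1) (Lamk k.+1) i j
    - lag_gradW X lam2 (Wk k.+1) (Pik k.+1) (Lamk k.+1) i j0| <= cX * (c0 * Num.sqrt (step k)).
Proof.
set e := c0 * Num.sqrt (step k).
have e0 : 0 <= e by rewrite mulr_ge0 ?sqrtr_ge0.
have [st _] := iterate_stationary l2 l3 j0 a0 m0 seqP k; have := st i j.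
have key j' : exists2 d, `|d| <= (l1norm X * alpha + mu) * e &
  lag_gradW X lam2 (Wk k.+1) (Pik k.+1 + alpha *: (Ak k.+1 - Ak k))
     (Lamk k.+1 + mu *: (Uk k.+1 - Uk k)) i j'
  = lag_gradW X lam2 (Wk k.+1) (Pik k.+1) (Lamk k.+1) i j' + d.
  exists (alpha * (\sum_l X i l * (Ak k.+1 - Ak k) l j') + mu * (Uk k.+1 - Uk k) i j').
    apply: le_trans (ler_normD _ _) _; rewrite !normrM (gtr0_norm a0) (gtr0_norm m0).
    rewrite mulrDl lerD ?ler_pM2l ?incU // [_ * alpha]mulrC -mulrA ler_pM2l //.
    apply: le_trans (ler_norm_sum _ _ _) _.
    apply: (@le_trans _ _ (\sum_l `|X i l| * e)).
      by apply: ler_sum => l _; rewrite normrM ler_wpM2l //; exact: incA.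
    by rewrite -mulr_suml ler_wpM2r.
  rewrite !lag_gradWE.
  have -> : \sum_l X i l * (Pik k.+1 + alpha *: (Ak k.+1 - Ak k)) l j'
     = \sum_l X i l * Pik k.+1 l j' + alpha * (\sum_l X i l * (Ak k.+1 - Ak k) l j').
    rewrite mulr_sumr -big_split /=; apply: eq_bigr => l _.
    by rewrite !mxE; ring.
  by rewrite !mxE; ring.
have [d dl ->] := key j; have [d' dl' ->] := key j0.
have h1 := mulr_ge0 (mulr_ge0 (ler0n R n) (ltW a0)) e0.
move: dl dl'; rewrite !ler_norml /cX; lra.
Qed.

Let gradb_residual k j :
  `|lag_gradb lam3 (bk k.+1) (Pik k.+1) j 0 - lag_gradb lam3 (bk k.+1) (Pik k.+1) j0 0|
    <= cX * (c0 * Num.sqrt (step k)).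
Proof.
set e := c0 * Num.sqrt (step k).
have e0 : 0 <= e by rewrite mulr_ge0 ?sqrtr_ge0.
have [_ st] := iterate_stationary l2 l3 j0 a0 m0 seqP k; have := st j.
have key j' : exists2 d, `|d| <= n%:R * alpha * e &
  lag_gradb lam3 (bk k.+1) (Pik k.+1 + alpha *: (Ak k.+1 - Ak k)) j' 0
  = lag_gradb lam3 (bk k.+1) (Pik k.+1) j' 0 + d.
  exists (\sum_l alpha * (Ak k.+1 - Ak k) l j').
    apply: le_trans (ler_norm_sum _ _ _) _.
    apply: (@le_trans _ _ (\sum_(l < n) alpha * e)).
      by apply: ler_sum => l _; rewrite normrM (gtr0_norm a0) ler_pM2l //; exact: incA.
    by rewrite sumr_const card_ord -mulrA mulr_natl.
  rewrite !lag_gradbE -addrA -big_split /=; congr (_ + _).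
  by apply: eq_bigr => l _; rewrite !mxE.
have [d dl ->] := key j; have [d' dl' ->] := key j0.
have h1 := mulr_ge0 (mulr_ge0 (l1norm_ge0 X) (ltW a0)) e0.
have h2 := mulr_ge0 (ltW m0) e0.
move: dl dl'; rewrite !ler_norml /cX; lra.
Qed.

Let cost_over_n i j : n%:R^-1 * cost R y i j <= 1.
Proof.
have n1 : n%:R^-1 <= 1 :> R by rewrite invf_le1 ?ltr0n // ler1n.
have : 0 <= n%:R^-1 :> R by rewrite invr_ge0 ler0n.
by rewrite /cost; case: ifP; rewrite ?mulr1 ?mulr0.
Qed.

(** Makes the factors [1 + 2 * |t i|] of the error bound uniform in [k]. Only [A] and [U] are
    treated here; the multipliers are confined by the subgradient conditions. *)
Let iterates_bounded : exists2 B, 0 <= B & forall k,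
  (forall i j, `|Ak k.+1 i j| <= B) /\ (forall i j, `|Uk k.+1 i j| <= B).
Proof.
have [s sP] := P1_saddle X y n0 l1 l2 l3 a0 m0.
pose V k := ip (uk k - s.2) (uk k - s.2) + ip (zk k - K1 X s.1) (zk k - K1 X s.1).
pose V1 := V 1%N.
have Vb k : V k.+1 <= V1 by
  exact: (V_bounded ipP (@inDx_cvx R p J) (f1_cvx l2 l3) (g1_cvx y l1) (K1_aff X) sq k sP).
have V10 : 0 <= c0 * Num.sqrt V1 by rewrite mulr_ge0 ?sqrtr_ge0.
exists (l1norm (margin X s.1.1 s.1.2) + l1norm s.1.1 + c0 * Num.sqrt V1).
  by rewrite !addr_ge0 ?l1norm_ge0.
move=> k; have hV := Vb k; rewrite {1}/V /ip /ip1 /pair_ip /= in hV.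
have w1 := wip_ge0 (Ak k.+1 - margin X s.1.1 s.1.2) a0.
have w2 := wip_ge0 (Uk k.+1 - s.1.1) m0.
have w3 := wip_ge0 (alpha^-1 *: Pik k.+1 - s.2.1) a0.
have w4 := wip_ge0 (mu^-1 *: Lamk k.+1 - s.2.2) m0.
have tri (x x' d e : R) : `|x - x'| <= d -> `|x'| <= e -> `|x| <= e + d.
  by rewrite !ler_norml; lra.
split=> i j.
- have : `|(Ak k.+1 - margin X s.1.1 s.1.2) i j| <= c0 * Num.sqrt V1.
    by apply: (entry_bound _ _ a0) => //; lra.
  rewrite [X in `|X|]mxE [X in `|_ + X|]mxE.
  move/tri => /(_ _ (entry_le_l1norm _ i j)) h; apply: le_trans h _.
  by have := l1norm_ge0 s.1.1; lra.
- have : `|(Uk k.+1 - s.1.1) i j| <= c0 * Num.sqrt V1.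
    by apply: (entry_bound _ _ m0) => //; lra.
  rewrite [X in `|X|]mxE [X in `|_ + X|]mxE.
  move/tri => /(_ _ (entry_le_l1norm _ i j)) h; apply: le_trans h _.
  by have := l1norm_ge0 (margin X s.1.1 s.1.2); lra.
Qed.

Let wip_entries m k (a d : R) (M : 'M[R]_(m, k)) : 0 < a -> 0 <= d ->
  (forall i j, `|M i j| <= d) -> wip a M M <= a * (m%:R * k%:R) * d ^+ 2.
Proof.
move=> ha hd h; rewrite /wip -mulrA ler_pM2l // innerE.
apply: (@le_trans _ _ (\sum_(i < m) \sum_(j < k) d ^+ 2)).
  apply: ler_sum => i _; apply: ler_sum => j _.
  by rewrite -expr2 -(real_normK (num_real (M i j))) ler_pXn2r ?nnegrE.
by rewrite !sumr_const !card_ord -mulrnA -[_ ^+ 2 *+ _]mulr_natl natrM [k%:R * _]mulrC.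
Qed.

Let step_cvg : step k @[k --> \oo] --> (0 : R).
Proof.
have [s sP] := P1_saddle X y n0 l1 l2 l3 a0 m0.
exact: (step_cvg0 ipP (@inDx_cvx R p J) (f1_cvx l2 l3) (g1_cvx y l1) (K1_aff X) sq sP).
Qed.

Let saddle_distance : exists (kap : R) (N : nat), 0 < kap /\
  forall k, (N <= k)%N -> exists2 s, sad s &
   ip (uk k.+2 - s.2) (uk k.+2 - s.2) + ip (zk k.+2 - K1 X s.1) (zk k.+2 - K1 X s.1)
     <= kap * step k.+1.
Proof.
have [kap kap0 kapP] := kkt_error_bound X y lam1 lam2 lam3 j0.
have [B B0 hB] := iterates_bounded.
pose ce := kap * (cX * c0).
have ce0 : 0 <= ce by rewrite /ce !mulr_ge0 // (le_trans _ cX_ge1).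
(* Covers all four blocks: [A] and [U] are bounded by [B], [Pi] by 1, and [lam1 + Lam] by
   [2 * lam1]. *)
pose B' := 1 + 2 * (B + 1 + 2 * lam1).
have lam10 := l1.
have B'0 : 0 <= B' by rewrite /B'; lra.
(* Penalty weight times number of entries for each block; the squared inverses come from the scaling
   of the dual variable. *)
pose Kt := alpha * (n%:R * J%:R) * (alpha^-1) ^+ 2 + mu * (p%:R * J%:R) * (mu^-1) ^+ 2
  + (alpha * (n%:R * J%:R) + mu * (p%:R * J%:R)).
have Kt0 : 0 <= Kt.
  by rewrite /Kt !addr_ge0 ?mulr_ge0 ?ler0n ?invr_ge0 ?ltW.
have [N NP] : exists N, forall k, (N <= k)%N -> ce * Num.sqrt (step k.+1) <= 1 / 2.
  pose d := 1 / (2 * (ce + 1)).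
  have d0 : 0 < d by rewrite divr_gt0 //; lra.
  have /cvgrPdist_le /(_ (d ^+ 2)) := step_cvg.
  rewrite exprn_gt0 // => /(_ isT) [N _ NP].
  exists N => k Nk; have := NP k.+1 (leqW Nk).
  rewrite /= sub0r normrN ger0_norm; last by rewrite /step; exact: (step_ge0 ipP).
  move=> h; have {h} : Num.sqrt (step k.+1) <= d.
    by rewrite -(gtr0_norm d0) -sqrtr_sqr ler_wsqrtr.
  move/(ler_wpM2l ce0)/le_trans; apply.
  by rewrite /d mulrA mulr1 ler_pdivrMr; lra.
exists (Kt * (ce * B') ^+ 2 + 1), N; split.
  by rewrite ltr_wpDl // mulr_ge0 ?sqr_ge0.
move=> k Nk; pose eta := cX * (c0 * Num.sqrt (step k.+1)).
have st0 : 0 <= step k.+1 by exact: (step_ge0 ipP).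
have e0 : 0 <= c0 * Num.sqrt (step k.+1) by rewrite mulr_ge0 ?sqrtr_ge0.
have eta_ge : c0 * Num.sqrt (step k.+1) <= eta by rewrite ler_peMl.
have eta0 : 0 <= eta by exact: le_trans eta_ge.
have keta : kap * eta = ce * Num.sqrt (step k.+1) by rewrite /eta /ce; ring.
have sg := iterate_subgradients l1 a0 m0 seqP k.+1.
have Dk : inD (Wk k.+2) (bk k.+2) by case: (seqP k.+1) => -[].
have [||||||Ws [bs [Pis [Lams [Ds sts sgs [dA dU dP dL]]]]]] :=
    kapP (Wk k.+2) (bk k.+2) (Ak k.+2) (Uk k.+2) (Pik k.+2) (Lamk k.+2) eta Dk sg.
- move=> i j; have := congr1 (fun M : 'M[R]_(n, J) => M i j) (residA k.+1).
  rewrite [X in X = _ -> _]mxE [X in _ + X = _ -> _]mxE => ->.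
  apply: le_trans eta_ge; exact: incP.
- move=> i j; have := congr1 (fun M : 'M[R]_(p, J) => M i j) (residU k.+1).
  rewrite [X in X = _ -> _]mxE [X in _ + X = _ -> _]mxE => ->.
  apply: le_trans eta_ge; exact: incL.
- exact: gradW_residual.
- exact: gradb_residual.
- exact: eta0.
- by rewrite keta; exact: NP.
exists ((Ws, bs), (alpha^-1 *: Pis, mu^-1 *: Lams)).
  exact: (kkt_saddle l1 l2 l3 a0 m0 Ds sts sgs).
pose d := kap * eta * B'.
have ke0 : 0 <= kap * eta by exact: mulr_ge0.
have d0 : 0 <= d by exact: mulr_ge0.
have weak (x v : R) : `|v| <= B + 1 + 2 * lam1 -> x <= kap * eta * (1 + 2 * `|v|) -> x <= d.
  move=> hv /le_trans; apply; by rewrite /d ler_wpM2l // /B'; lra.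
have [hBA hBU] := hB k.+1.
have [sgA sgU] := sg.
have hA i j : `|(Ak k.+2 - margin X Ws bs) i j| <= d.
  rewrite [X in `|X|]mxE [X in `|_ + X|]mxE; apply: weak (dA i j).
  by have := hBA i j; lra.
have hU i j : `|(Uk k.+2 - Ws) i j| <= d.
  rewrite [X in `|X|]mxE [X in `|_ + X|]mxE; apply: weak (dU i j).
  by have := hBU i j; lra.
have hP i j : `|(alpha^-1 *: Pik k.+2 - alpha^-1 *: Pis) i j| <= alpha^-1 * d.
  rewrite -scalerBr !mxE normrM ger0_norm ?invr_ge0 ?(ltW a0) //.
  rewrite ler_pM2l ?invr_gt0 //; apply: weak (dP i j).
  have [h1 h2 _ _] := sgA i j; rewrite ger0_norm //; have := cost_over_n i j; lra.
have hL i j : `|(mu^-1 *: Lamk k.+2 - mu^-1 *: Lams) i j| <= mu^-1 * d.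
  rewrite -scalerBr !mxE normrM ger0_norm ?invr_ge0 ?(ltW m0) //.
  rewrite ler_pM2l ?invr_gt0 //; apply: weak (dL i j).
  have [h1 h2 _ _] := sgU i j; rewrite ger0_norm //; lra.
have ai : 0 <= alpha^-1 by rewrite invr_ge0 ltW.
have mi : 0 <= mu^-1 by rewrite invr_ge0 ltW.
have := wip_entries a0 d0 hA; have := wip_entries m0 d0 hU.
have := wip_entries a0 (mulr_ge0 ai d0) hP; have := wip_entries m0 (mulr_ge0 mi d0) hL.
have dsq : d ^+ 2 = (ce * B') ^+ 2 * step k.+1.
  by rewrite /d keta -[in RHS](sqr_sqrtr st0); ring.
rewrite (exprMn _ mu^-1 d) (exprMn _ alpha^-1 d) => q1 q2 q3 q4.
have tot : ip (uk k.+2 - (alpha^-1 *: Pis, mu^-1 *: Lams))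
     (uk k.+2 - (alpha^-1 *: Pis, mu^-1 *: Lams))
   + ip (zk k.+2 - K1 X (Ws, bs)) (zk k.+2 - K1 X (Ws, bs)) <= Kt * d ^+ 2.
  apply: (le_trans (lerD (lerD q2 q1) (lerD q4 q3))).
  by rewrite le_eqVlt; apply/orP; left; apply/eqP; rewrite /Kt; ring.
apply: le_trans tot _; by rewrite dsq mulrA ler_wpM2r // lerDl.
Qed.

Lemma P1_linear : lin_conv1 Wk bk Ak Uk Pik Lamk.
Proof.
have [kap [N [kap0 err]]] := saddle_distance.
have [s0 s0P] := P1_saddle X y n0 l1 l2 l3 a0 m0.
have [C [r [r01 hstep]]] := admm_linear ipP (@inDx_cvx R p J) (f1_cvx l2 l3) (g1_cvx y l1)
  (K1_aff X) sq s0P kap0 err.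
have /andP[r0 r1] := r01.
(* [step] is a squared length, so the increments themselves decay at the square root of its rate. *)
pose rho := Num.sqrt r.
have rho0 : 0 < rho by rewrite sqrtr_gt0.
have rho1 : rho < 1 by rewrite -sqrtr1 ltr_sqrt.
have C0 : 0 <= C.
  by have := hstep 0; rewrite expr0 mulr1; apply: le_trans; exact: (step_ge0 ipP).
have hsq k : Num.sqrt (step (N + k).+1) <= Num.sqrt C * rho ^+ k.
  apply: le_trans (ler_wsqrtr (hstep k)) _.
  rewrite sqrtrM // -{1}(sqr_sqrtr (ltW r0)) -exprM mulnC exprM sqrtr_sqr ger0_norm //.
have geo (a : nat -> R) (c : R) : 0 <= c ->
    (forall k, `|a k.+1 - a k| <= c * (c0 * Num.sqrt (step k))) -> geometric_cvg rho a.
  move=> c0' h; apply: (geometric_of_shift rho0 (N := N.+1)).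
  apply: (geometric_increments rho0 rho1 (C := c * (c0 * Num.sqrt C))) => k.
  rewrite addnS !addSn; apply: le_trans (h _) _.
  by rewrite -2!mulrA ler_wpM2l // ler_wpM2l.
have gA i j : geometric_cvg rho (fun k => Ak k i j).
  by apply: (geo _ 1) => // k; rewrite mul1r; have := incA k i j; rewrite mxE [X in _ + X]mxE.
have gU i j : geometric_cvg rho (fun k => Uk k i j).
  by apply: (geo _ 1) => // k; rewrite mul1r; have := incU k i j; rewrite mxE [X in _ + X]mxE.
have gP i j : geometric_cvg rho (fun k => Pik k i j).
  apply: (geo _ alpha) => [|k]; first exact: ltW.
  have := incP k i j; rewrite -scalerBr !mxE.
  by rewrite normrM ger0_norm ?invr_ge0 ?(ltW a0) // ler_pdivrMl.
have gL i j : geometric_cvg rho (fun k => Lamk k i j).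
  apply: (geo _ mu) => [|k]; first exact: ltW.
  have := incL k i j; rewrite -scalerBr !mxE.
  by rewrite normrM ger0_norm ?invr_ge0 ?(ltW m0) // ler_pdivrMl.
(* The first block does not enter [step]. The update of [Lam] expresses [W] through [U] and an
   increment of [Lam], from index 1 on. *)
have gW i j : geometric_cvg rho (fun k => Wk k i j).
  apply: (geometric_of_shift rho0 (N := 1)).
  have -> : (fun k => Wk (1 + k)%N i j)
      = (fun k => Uk k.+1 i j + mu^-1 * (Lamk k.+1 i j - Lamk k i j)).
    apply/funext => k; rewrite add1n.
    have := congr1 (fun M : 'M[R]_(p, J) => M i j) (residU k); rewrite -scalerBr !mxE => <-.
    ring.
  apply: geometric_add; first exact: (geometric_shift (gU i j)).
  apply: geometric_scale; apply: geometric_sub => //; exact: (geometric_shift (gL i j)).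
(* Row [i0] of the margin identity, for any one sample, can be solved for [b]. *)
have gb i j : geometric_cvg rho (fun k => bk k i j).
  rewrite (ord1 j) {j}; apply: (geometric_of_shift rho0 (N := 1)).
  have -> : (fun k => bk (1 + k)%N i 0)
      = (fun k => Ak k.+1 i0 i + alpha^-1 * (Pik k.+1 i0 i - Pik k i0 i)
           - \sum_l X l i0 * Wk k.+1 l i - 1).
    apply/funext => k; rewrite add1n.
    have := congr1 (fun M : 'M[R]_(n, J) => M i0 i) (residA k); rewrite -scalerBr.
    rewrite [X in X = _ -> _]mxE [X in _ + X = _ -> _]mxE marginE !mxE; lra.
  apply: geometric_sub; last exact: geometric_cst.
  apply: geometric_sub.
    apply: geometric_add; first exact: (geometric_shift (gA i0 i)).
    apply: geometric_scale; apply: geometric_sub => //; exact: (geometric_shift (gP i0 i)).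
  by apply: geometric_sum => l; apply: geometric_scale; exact: (geometric_shift (gW l i)).
have [Ws [C1 h1]] := geometric_matrix gW; have [bs [C2 h2]] := geometric_matrix gb.
have [As [C3 h3]] := geometric_matrix gA; have [Us [C4 h4]] := geometric_matrix gU.
have [Pis [C5 h5]] := geometric_matrix gP; have [Lams [C6 h6]] := geometric_matrix gL.
exists Ws, bs, As, Us, Pis, Lams, (C1 + C2 + C3 + C4 + C5 + C6), rho.
rewrite rho0 rho1; split => // k.
by rewrite !mulrDl !lerD.
Qed.

End LinearRate.

Theorem theorem1 (R : realType) (n p J : nat)
  (hn : (2 <= n)%N) (hp : (2 <= p)%N) (hJ : (2 <= J)%N)
  (X : 'M[R]_(p, n)) (y : 'I_n -> 'I_J) (lam1 lam2 lam3 : R)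
  (hl1 : 0 <= lam1) (hl2 : 0 <= lam2) (hl3 : 0 < lam3) :
  (forall (alpha mu : R)
     (Wk : nat -> 'M[R]_(p, J)) (bk : nat -> 'cV[R]_J) (Ak : nat -> 'M[R]_(n, J))
     (Uk : nat -> 'M[R]_(p, J)) (Pik : nat -> 'M[R]_(n, J))
     (Lamk : nat -> 'M[R]_(p, J)),
     0 < alpha -> 0 < mu ->
     admm1 X y lam1 lam2 lam3 alpha mu Wk bk Ak Uk Pik Lamk ->
     [/\ ((fun k : nat => (F1 y lam1 lam2 lam3 (Wk k) (bk k) (Ak k) (Uk k) : R)) @ \oo)
           --> (F1star X y lam1 lam2 lam3 : R),
         ((fun k : nat => (frob (resid X (Wk k) (bk k) (Ak k)) : R)) @ \oo) --> (0 : R),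
         ((fun k : nat => (frob (Wk k - Uk k) : R)) @ \oo) --> (0 : R)
       & (0 < lam2 -> lin_conv1 Wk bk Ak Uk Pik Lamk)])
  /\
  (forall (q : qexp) (alpha mu nu : R)
     (Wk : nat -> 'M[R]_(p, J)) (bk : nat -> 'cV[R]_J) (Ak : nat -> 'M[R]_(n, J))
     (Uk Vk : nat -> 'M[R]_(p, J)) (Pik : nat -> 'M[R]_(n, J))
     (Lamk Gamk : nat -> 'M[R]_(p, J)),
     0 < alpha -> 0 < mu -> 0 < nu ->
     admm2 q X y lam1 lam2 lam3 alpha mu nu Wk bk Ak Uk Vk Pik Lamk Gamk ->
     [/\ ((fun k : nat => (F2 q y lam1 lam2 lam3 (Wk k) (bk k) (Ak k) (Uk k) (Vk k) : R)) @ \oo)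
           --> (F2star q X y lam1 lam2 lam3 : R),
         ((fun k : nat => (frob (resid X (Wk k) (bk k) (Ak k)) : R)) @ \oo) --> (0 : R),
         ((fun k : nat => (frob (Wk k - Uk k) : R)) @ \oo) --> (0 : R)
       & ((fun k : nat => (frob (Wk k - Vk k) : R)) @ \oo) --> (0 : R)]).
Proof.
have n0 : (0 < n)%N by exact: leq_trans hn.
have J0 : (0 < J)%N by exact: leq_trans hJ.
split=> [alpha mu Wk bk Ak Uk Pik Lamk a0 m0 h|q alpha mu nu Wk bk Ak Uk Vk Pik Lamk Gamk a0 m0 v0 h].
  have [c1 c2 c3] := P1_convergence n0 hl1 hl2 hl3 a0 m0 h.
  by split=> // _; exact: (P1_linear hl1 hl2 hl3 (Ordinal n0) (Ordinal J0) a0 m0 h).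
exact: (P2_convergence n0 hl1 hl2 hl3 a0 m0 v0 h).
Qed.
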